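(* Consider the stochastic energy exchange model, its time-$h$ sampling chain, and the set $\mathfrak{C}$ described in the context; let $\hat V=\max\{1,V\}$, $\hat W=\max\{1,W\}$, $\hat\alpha=2-2\eta$, and $\tau_{\mathfrak{C}}=\inf\{n>0:\mathbf{E}_{nh}\in\mathfrak{C}\}$. For any $\epsilon>0$ there exists a constant $C_6<\infty$ such that $$\mathbb{P}_{\mathbf{E}}[\tau_{\mathfrak{C}}>n]\le C_6\big(\hat W(\mathbf{E})+\hat V(\mathbf{E})\big)n^{-(\hat\alpha-\epsilon)}$$ for all $\mathbf{E}\in\mathbb{R}^N_+$ and all $n\ge1$.
   Context: Fix $N\ge1$, $T_L,T_R>0$, a sufficiently large $K$ ($K\gg T_L,T_R$) and $R(a,b)=\min\{K,\sqrt{\min(a,b)}\}$. The stochastic energy exchange model is the Markov jump process $\mathbf{E}_t=(E_1(t),\dots,E_N(t))$ on $\mathbb{R}^N_+$: for $i=1,\dots,N-1$ a clock of rate $R(E_i,E_{i+1})$ on sites $i,i+1$; when it rings $(E_i,E_{i+1})\mapsto(p(E_i+E_{i+1}),(1-p)(E_i+E_{i+1}))$, $p$ uniform on $(0,1)$; a clock of rate $R(T_L,E_1)$ (resp. $R(E_N,T_R)$) with $E_1\mapsto p(E_1+X_L)$ (resp. $E_N\mapsto p(E_N+X_R)$), $X_L,X_R$ exponential with means $T_L,T_R$; all independent. $P^t$ is its transition kernel. Let $W(\mathbf{E})=\sum_iE_i$, $a_m=1-\frac{2^{m-1}-1}{2^N-1}$, and $V(\mathbf{E})=\sum_{m=1}^N\sum_{k=1}^{N-m+1}\big(\sum_{j=0}^{m-1}E_{k+j}\big)^{a_m\eta-1}$.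 Fix sufficiently small $\eta>0$ and $h>0$; $M_0>1$ is a constant such that $P^hV-V\le-c_0V^{\alpha}$ on $\{V>M_0\}$ ($c_0>0$, $\alpha=1-\frac1{2(1-\eta)}$); with $G=\{V\le M_0\}$, return times $T_0=0$, $T_{n+1}=\inf\{k>T_n:\mathbf{E}_{kh}\in G\}$ and induced kernel $\hat PW(\mathbf{E})=\mathbb{E}_{\mathbf{E}}[W(\mathbf{E}_{T_1h})]$, $M_1>1$ is a constant such that $\hat PW\le(1-\delta)W$ on $G\cap\{W>M_1\}$ for some $\delta>0$. $\mathfrak{C}=\{\mathbf{E}:V(\mathbf{E})\le M_0,\ W(\mathbf{E})\le M_1\}$. *)

(* Defs.v *)
From HB Require Import structures.
From mathcomp Require Import all_boot all_order all_algebra.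
From mathcomp Require Import all_classical all_reals all_analysis.
Set Implicit Arguments. Unset Strict Implicit. Unset Printing Implicit Defensive.
Import Order.TTheory GRing.Theory Num.Theory.
Local Open Scope classical_set_scope.
Local Open Scope ring_scope.

Section SEEM.
Variable R : realType.
Variable N : nat.

Definition state := 'I_N -> R.

(* E_i for a nat index i (0-based); 0 outside the range (never used there). *)
Definition Eat (E : state) (i : nat) : R := oapp E 0 (insub i).

Definition pos_state (E : state) : Prop := forall i : 'I_N, 0 < E i.

Definition rate (K a b : R) : R := Num.min K (Num.sqrt (Num.min a b)).

Definition Wf (E : state) : R := \sum_(i < N) E i.

Definition a_coef (m : nat) : R :=
  1 - ((2 : R) ^+ m.-1 - 1) / ((2 : R) ^+ N - 1).

Definition Vf (eta : R) (E : state) : R :=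
  \sum_(1 <= m < N.+1) \sum_(0 <= k < N - m + 1)
     powR (\sum_(0 <= j < m) Eat E (k + j)) (a_coef m * eta - 1).

Definition upd2 (E : state) (i : nat) (p : R) : state :=
  fun j => let s := Eat E i + Eat E i.+1 in
           if val j == i then p * s
           else if val j == i.+1 then (1 - p) * s
           else E j.
Definition upd1 (E : state) (i : nat) (p x : R) : state :=
  fun j => if val j == i then p * (Eat E i + x) else E j.

Local Open Scope ereal_scope.

Definition unif_int (g : R -> \bar R) : \bar R :=
  \int[@lebesgue_measure R]_(p in `]0%R, 1%R[%classic) g p.

Definition expo_int (T : R) (g : R -> \bar R) : \bar R :=
  \int[@lebesgue_measure R]_(x in `]0%R, +oo[%classic)
     ((T^-1 * expR (- (x / T)))%:E * g x).

Definition total_rate (K TL TR : R) (E : state) : R :=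
  (\sum_(0 <= i < N.-1) rate K (Eat E i) (Eat E i.+1))
  + rate K TL (Eat E 0) + rate K (Eat E N.-1) TR.

(* uniformization constant: every rate is <= K and there are N+1 clocks *)
Definition Lam (K : R) : R := (N.+1)%:R * K.

(* one-step kernel J of the uniformized chain, acting on nonnegative
   functions; the generator is L f = Lam (J f - f). *)
Definition Jker (K TL TR : R) (f : state -> \bar R) (E : state) : \bar R :=
  (Lam K)^-1%:E *
    ((\sum_(0 <= i < N.-1)
        (rate K (Eat E i) (Eat E i.+1))%:E * unif_int (fun p => f (upd2 E i p)))
     + (rate K TL (Eat E 0))%:E *
         unif_int (fun p => expo_int TL (fun x => f (upd1 E 0 p x)))
     + (rate K (Eat E N.-1) TR)%:E *
         unif_int (fun p => expo_int TR (fun x => f (upd1 E N.-1 p x))))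
  + (1 - total_rate K TL TR E / Lam K)%:E * f E.

Definition Pt (K TL TR t : R) (f : state -> \bar R) (E : state) : \bar R :=
  \sum_(0 <= k <oo)
    (expR (- (Lam K * t)) * (Lam K * t) ^+ k / (k`!)%:R)%:E
      * iter k (Jker K TL TR) f E.

Definition Cset (eta M0 M1 : R) (E : state) : bool :=
  (Vf eta E <= M0)%R && (Wf E <= M1)%R.

(* P_E[tau_C > n] for the time-h sampled chain, tau_C = inf{n>0 : E_{nh} in C}:
   u_0 = 1, u_{k+1} = P^h (1_{C^c} u_k); then u_n(E) = P_E[E_h,...,E_{nh} not in C]. *)
Definition surv (K TL TR h eta M0 M1 : R) (n : nat) : state -> \bar R :=
  iter n (fun u => Pt K TL TR h
            (fun y => if Cset eta M0 M1 y then 0 else u y)) (fun _ => 1).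

(* induced kernel on G = {V <= M0}:  hat P W (E) = E_E[W(E_{T_1 h})]
   = sum_{k>=1} E_E[W(E_{kh}); T_1 = k], computed by
   g_1 = P^h(1_G W), g_{k+1} = P^h(1_{G^c} g_k). *)
Definition ret_term (K TL TR h eta M0 : R) (k : nat) : state -> \bar R :=
  iter k (fun g => Pt K TL TR h
            (fun y => if (Vf eta y <= M0)%R then 0 else g y))
       (Pt K TL TR h (fun y => if (Vf eta y <= M0)%R then (Wf y)%:E else 0)).

Definition hatPW (K TL TR h eta M0 : R) (E : state) : \bar R :=
  \sum_(0 <= k <oo) ret_term K TL TR h eta M0 k E.

End SEEM.

(* Main.v *)
Require Import Defs.
From HB Require Import structures.
From mathcomp Require Import all_boot all_order all_algebra.
From mathcomp Require Import all_classical all_reals all_analysis.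
From mathcomp Require Import measurable_realfun zify ring lra.
Import Order.TTheory GRing.Theory Num.Theory.
Import numFieldNormedType.Exports.
Local Open Scope classical_set_scope.
Local Open Scope ring_scope.

Set Implicit Arguments.
Unset Strict Implicit.
Unset Printing Implicit Defensive.

(** Write [P] for the kernel [P^h], [b = 2 - 2 eta], so that the exponent in the
    drift of [V] is [1 - 1/b], and [G = {V <= M0}].

    The functions [(V^(1/b) + kap n)^b] are concave in [V]; bounding them by
    their tangents, the drift of [V] makes them supersolutions outside [G], and
    the return time to [G] has a tail bounded by [C V n^-b].  As [V] decreases
    by at least a constant in mean outside [G] and [W] grows at most by a
    constant, [W + A V] is another supersolution, which bounds the mean of [W]
    at the return to [G] by [C (W + V)].

    From a point of [G], as long as the core [{V <= M0, W <= M1}] is not met,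
    an excursion away from [G] either lasts more than [L] steps, with probability
    [O(L^-b)], or multiplies the mean of [W] by at most [rho < 1].  Hence
    avoiding the core for [(k+1) L] steps has probability at most
    [C (W + V) (rho^k + (k+1) L^-b)], and one takes [k ~ n^s] with a small
    power [s] of [n], and [L ~ n/k].

    The required a priori bounds are [P W <= W + C], because exchanges conserve
    [W], and [P V <= C V], because an exchange multiplies each energy by at least
    [min(p, 1 - p)] and a negative power of this is integrable. *)

(** * Power inequalities *)

(** Young's inequality for [t] and [z^(b-1)] with the conjugate exponents [b] and [b/(b-1)]. The
    left-hand side is the tangent at [z] of the convex function [t^b], with [z^(b-1)] factored
    out. *)
Lemma powR_tangent (R : realType) (b z t : R) : 1 < b -> 0 <= t -> 0 < z ->
  z `^ (b - 1) * (z - b * (z - t)) <= t `^ b.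
Proof.
move=> b1 t0 z0.
have b0 : 0 < b by lra.
have bN0 : b != 0 by rewrite gt_eqF.
have b10 : 0 < b - 1 by lra.
have b1N0 : b - 1 != 0 by rewrite gt_eqF.
have := @conjugate_powR R t (z `^ (b - 1)) b (b / (b - 1)) t0 (powR_ge0 _ _) b0.
rewrite divr_gt0// => /(_ isT).
have -> : b^-1 + (b / (b - 1))^-1 = 1 by field; rewrite bN0 b1N0.
move=> /(_ erefl).
have -> : (z `^ (b - 1)) `^ (b / (b - 1)) = z * z `^ (b - 1).
  by rewrite -powRrM mulr_powRB1 ?ltW//; congr (_ `^ _); field.
have u0 := powR_ge0 z (b - 1).
move: (z `^ _) (t `^ _) u0 => u w u0.
rewrite -(ler_pM2l b0).
have -> : b * (w / b + z * u / (b / (b - 1))) = w + (b - 1) * (z * u) by field; rewrite bN0 b1N0.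
nra.
Qed.

(* The right-hand side is the tangent at [y `^ b] of the left-hand side, which
   is a concave function of [x]. *)
Lemma powR_shift_tangent (R : realType) (b x y a : R) : 1 < b -> 0 <= x -> 0 < y -> 0 <= a ->
  (x `^ b^-1 + a) `^ b <=
  ((y + a) / y) `^ (b - 1) * x + (y + a) `^ (b - 1) * a.
Proof.
move=> b1 x0 y0 a0.
have b0 : 0 < b by lra.
have ya0 : 0 < y + a by lra.
have yN0 : y != 0 by rewrite gt_eqF.
have yaN0 : y + a != 0 by rewrite gt_eqF.
set X := x `^ b^-1.
have X0 : 0 <= X by exact: powR_ge0.
have -> : x = X `^ b by rewrite /X -powRrM mulVf ?gt_eqF// powRr1.
have [Xa0|Xa0] := eqVneq (X + a) 0.
  rewrite Xa0 powR0 ?gt_eqF// addr_ge0// mulr_ge0// ?powR_ge0//.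
have Z0 : 0 < X + a by rewrite lt_neqAle eq_sym Xa0 addr_ge0.
(* [X + a] is the mean of [X (y+a)/y] and [y + a] with weights [y/(y+a)] and [a/(y+a)]. Both
   tangents are taken at this mean, so their linear terms cancel in the weighted sum. *)
have t10 : 0 <= X * ((y + a) / y) by rewrite mulr_ge0// divr_ge0// ltW.
have h1 := @powR_tangent _ _ _ _ b1 t10 Z0.
have h2 := @powR_tangent _ _ _ _ b1 (ltW ya0) Z0.
rewrite powRM// in h1; last by rewrite divr_ge0// ltW.
have e1 : 0 <= (y + a) / y by rewrite divr_ge0// ltW.
rewrite -(mulr_powRB1 e1 b0) in h1.
rewrite -(mulr_powRB1 (ltW ya0) b0) in h2.
rewrite -(mulr_powRB1 (ltW Z0) b0).
set s := (_ / y) `^ _ in h1 *.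
set t := (y + a) `^ _ in h2 *.
set z := (X + a) `^ _ in h1 h2 *.
set xb := X `^ b in h1 *.
have h1' := ler_wpM2l (ltW y0) h1.
have h2' := ler_wpM2l a0 h2.
have := lerD h1' h2'.
have -> : y * (z * (X + a - b * (X + a - X * ((y + a) / y)))) +
    a * (z * (X + a - b * (X + a - (y + a)))) = (y + a) * ((X + a) * z) by field.
have -> : y * (xb * ((y + a) / y * s)) + a * ((y + a) * t) = (y + a) * (s * xb + t * a) by field.
by rewrite ler_pM2l.
Qed.

(** * Avoidance of the core under a double drift condition *)

(* [D] is the part of the space on which the operator is controlled, and [nice]
   a class of functions, nonnegative on [D], on which it is linear. *)
Record submarkov (R : realType) (T : Type) (D : T -> Prop)
    (nice : (T -> \bar R) -> Prop) (P : (T -> \bar R) -> T -> \bar R) : Prop :=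
  Submarkov {
  nice_ge0 : forall f y, nice f -> D y -> (0 <= f y)%E ;
  nice_cst : forall c : R, 0 <= c -> nice (fun=> c%:E) ;
  niceD : forall f g, nice f -> nice g -> nice (fun y => f y + g y)%E ;
  niceZ : forall a f, 0 <= a -> nice f -> nice (fun y => a%:E * f y)%E ;
  nice_op : forall f, nice f -> nice (P f) ;
  op_ge0 : forall f, (forall y, D y -> 0 <= f y)%E ->
    forall y, D y -> (0 <= P f y)%E ;
  op_le : forall f g, (forall y, D y -> 0 <= f y)%E ->
    (forall y, D y -> f y <= g y)%E -> forall y, D y -> (P f y <= P g y)%E ;
  opD : forall f g, nice f -> nice g -> forall y, D y ->
    (P (fun x => f x + g x) y = P f y + P g y)%E ;
  opZ : forall a f, 0 <= a -> nice f -> forall y, D y ->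
    (P (fun x => a%:E * f x) y = a%:E * P f y)%E ;
  op1 : forall y, D y -> (P (fun=> 1) y <= 1)%E }.

Section drift.
Variables (R : realType) (T : Type) (D : T -> Prop).
Variables (nice : (T -> \bar R) -> Prop) (P : (T -> \bar R) -> T -> \bar R).
Hypothesis PP : submarkov D nice P.
Variables (V W : T -> R).
Hypothesis nice_V : nice (fun y => (V y)%:E).
Hypothesis nice_W : nice (fun y => (W y)%:E).
Variables M0 M1 : R.
Hypothesis nice_if : forall f g, nice f -> nice g ->
  nice (fun y => if V y <= M0 then f y else g y).

Let V_ge0 y : D y -> 0 <= V y.
Proof. by move=> Dy; have := nice_ge0 PP nice_V Dy; rewrite lee_fin. Qed.

Let W_ge0 y : D y -> 0 <= W y.
Proof. by move=> Dy; have := nice_ge0 PP nice_W Dy; rewrite lee_fin. Qed.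

Lemma op_affine_le f a b y : nice f -> 0 <= a -> 0 <= b -> D y ->
  (P (fun x => a%:E * f x + b%:E) y <= a%:E * P f y + b%:E)%E.
Proof.
move=> nf a0 b0 Dy.
have nb := nice_cst PP b0.
rewrite (opD PP (niceZ PP a0 nf) nb Dy) (opZ PP a0 nf Dy) leeD2l//.
rewrite (_ : (fun=> b%:E) = (fun x : T => b%:E * 1)%E); last first.
  by apply/funext => x; rewrite mule1.
rewrite (opZ PP b0 (nice_cst PP ler01) Dy) -[leRHS]mule1.
by apply: lee_wpmul2l; rewrite ?lee_fin//; exact: (op1 PP).
Qed.

Lemma op_sum (f : nat -> T -> \bar R) l y : (forall j, nice (f j)) -> D y ->
  nice (fun x => \sum_(0 <= j < l) f j x)%E /\
  P (fun x => \sum_(0 <= j < l) f j x)%E y = (\sum_(0 <= j < l) P (f j) y)%E.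
Proof.
move=> nf Dy; elim: l => [|l [nl IH]].
  rewrite (_ : (fun x => _) = (fun x => 0%:E)); last first.
    by apply/funext => x; rewrite big_geq.
  split; first exact: (nice_cst PP).
  (* [P 0 = 0] follows from homogeneity with the factor 0. *)
  rewrite big_geq// (_ : (fun x => _) = (fun x => 0%:E * 1%:E)%E); last first.
    by apply/funext => x; rewrite mul0e.
  by rewrite (opZ PP _ (nice_cst PP ler01))// mul0e.
rewrite (_ : (fun x => _) = (fun x => \sum_(0 <= j < l) f j x + f l x)%E); last first.
  by apply/funext => x; rewrite big_nat_recr.
split; first exact: (niceD PP).
by rewrite (opD PP)// IH big_nat_recr.
Qed.

(** * Tail of the return time to [G = {V <= M0}] *)

Variables (b c0 : R).
Hypothesis b_gt1 : 1 < b.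
Hypothesis c0_gt0 : 0 < c0.
Hypothesis M0_gt1 : 1 < M0.
Hypothesis drift_V : forall y, D y -> M0 < V y ->
  (P (fun x => (V x)%:E) y <= (V y - c0 * V y `^ (1 - b^-1))%:E)%E.
Variables (CV BW : R).
Hypothesis CV_ge0 : 0 <= CV.
Hypothesis BW_ge0 : 0 <= BW.
Hypothesis PV_le : forall y, D y -> (P (fun x => (V x)%:E) y <= (CV * V y)%:E)%E.
Hypothesis PW_le : forall y, D y -> (P (fun x => (W x)%:E) y <= (W y + BW)%:E)%E.

(** One step of the chain killed on entering [G]; [iter n taboo 1] at [y] is the probability that
    the return time [T_1] to [G] exceeds [n]. *)
Definition taboo (f : T -> \bar R) : T -> \bar R :=
  P (fun y => if V y <= M0 then 0%E else f y).

(** Along [v' = - c0 v^(1-1/b)] the quantity [v^(1/b)] decreases at speed [c0/b], so a slope at most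
    [c0/b] can be compensated by the drift. The cap at 1 gives [kap <= V^(1/b)] outside [G], which
    starts the induction on the tail. *)
Let kap := Num.min 1 (c0 / b).

Let b_gt0 : 0 < b. Proof. exact: lt_trans b_gt1. Qed.

Let kap_gt0 : 0 < kap.
Proof. by rewrite lt_min ltr01 divr_gt0. Qed.

Let kap_le1 : kap <= 1.
Proof. by rewrite ge_min lexx. Qed.

Let bkap : b * kap <= c0.
Proof.
have : kap <= c0 / b by rewrite ge_min lexx orbT.
by rewrite ler_pdivlMr// mulrC.
Qed.

Let hV (m : nat) y := (V y `^ b^-1 + kap * m%:R) `^ b.

(** The concave function of [V] under [P] is replaced by its tangent at [V y], to which the drift
    applies. What remains is the tangent inequality for [t^b] between [Y + a] and [Y + a - kap],
    with [b kap <= c0]. The factor [r] carries the normalisation used in the tail bound. *)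
Lemma op_power_drift (m : nat) (r : R) y : 0 <= r -> D y -> M0 < V y ->
  (P (fun x => (r * hV m.+1 x)%:E) y <= (r * hV m y)%:E)%E.
Proof.
have b1 := b_gt1; have M01 := M0_gt1; have bk := bkap.
move=> r0 Dy My.
have v0 : 0 < V y by lra.
set Y := V y `^ b^-1.
have Y0 : 0 < Y by exact: powR_gt0.
have vE : V y = Y `^ b by rewrite /Y -powRrM mulVf ?gt_eqF// powRr1// ltW.
set a := kap * m.+1%:R.
have a0 : 0 <= a by rewrite mulr_ge0// ltW.
set s := ((Y + a) / Y) `^ (b - 1).
set t := (Y + a) `^ (b - 1).
have s0 : 0 <= s by exact: powR_ge0.
have t0 : 0 <= t by exact: powR_ge0.
have ineq x : D x -> r * hV m.+1 x <= (r * s) * V x + r * (t * a).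
  move=> Dx; rewrite -mulrA -mulrDr ler_wpM2l//.
  exact: (powR_shift_tangent b_gt1 (V_ge0 Dx) Y0 a0).
apply: (@le_trans _ _ (P (fun x => (r * s)%:E * (V x)%:E + (r * (t * a))%:E)%E y)).
  apply: (op_le PP _ _ Dy) => x Dx.
    by rewrite lee_fin mulr_ge0 ?powR_ge0.
  by rewrite -EFinM -EFinD lee_fin; exact: ineq.
have rs0 : 0 <= r * s by exact: mulr_ge0.
have rta0 : 0 <= r * (t * a) by exact: mulr_ge0 r0 (mulr_ge0 t0 a0).
apply: le_trans; first exact: (op_affine_le nice_V rs0 rta0 Dy).
apply: (@le_trans _ _ ((r * s)%:E * (V y - c0 * V y `^ (1 - b^-1))%:E + (r * (t * a))%:E)%E).
  by rewrite leeD2r// lee_wpmul2l ?lee_fin//; exact: drift_V.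
rewrite -EFinM -EFinD lee_fin -mulrA -mulrDr ler_wpM2l//.
have -> : V y `^ (1 - b^-1) = Y `^ (b - 1).
  by rewrite vE -powRrM mulrBr mulr1 mulfV ?gt_eqF.
(* These identities express the slope and the drift through [t = (Y+a)^(b-1)] alone. *)
have st : s * Y `^ (b - 1) = t.
  have Ya : 0 <= (Y + a) / Y by exact: divr_ge0 (addr_ge0 (ltW Y0) a0) (ltW Y0).
  by rewrite /s -(powRM _ Ya (ltW Y0)) divfK// gt_eqF.
have sv : s * V y = t * Y.
  by rewrite vE -(mulr_powRB1 (ltW Y0) b_gt0) mulrCA st mulrC.
rewrite mulrBr sv mulrCA st.
have Ya0 : 0 < Y + a by rewrite ltr_pwDl.
have aE : Y + kap * m%:R = Y + a - kap by rewrite /a -addn1 natrD; ring.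
have tge0 : 0 <= Y + a - kap.
  by rewrite -aE addr_ge0 ?mulr_ge0// ltW.
have := powR_tangent b_gt1 tge0 Ya0.
rewrite /hV -/Y aE -/t; apply: le_trans.
have -> : t * Y - c0 * t + t * a = t * (Y + a - c0) by ring.
by rewrite ler_wpM2l//; lra.
Qed.

(** Each step lowers [n] and raises [m], so the normalisation, which depends on [n + m] only, stays
    fixed. At [n = 0] the bound is at least 1, because [V^(1/b) >= 1 >= kap] outside [G]. *)
Lemma taboo_tail_out n m y : D y -> M0 < V y ->
  (iter n taboo (fun=> 1) y <= (((kap * (n + m).+1%:R) `^ b)^-1 * hV m y)%:E)%E.
Proof.
have M01 := M0_gt1.
elim: n m y => [|n IH] m y Dy My.
  rewrite /= add0n lee_fin mulrC ler_pdivlMr ?powR_gt0 ?mulr_gt0// mul1r.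
  have km0 : 0 <= kap * m%:R by rewrite mulr_ge0// ltW.
  apply: ge0_ler_powR; rewrite ?nnegrE; first exact: ltW.
  - by rewrite mulr_ge0// ltW.
  - exact: addr_ge0 (powR_ge0 _ _) km0.
  rewrite -addn1 natrD mulrDr addrC mulr1 lerD2r (le_trans kap_le1)//.
  by rewrite -[leLHS](powRr0 (V y)) ler_powR// ?invr_ge0 ?(ltW b_gt0)//; lra.
rewrite /= {1}/taboo; apply: le_trans (op_power_drift _ _ Dy My); last first.
  by rewrite invr_ge0 powR_ge0.
apply: (op_le PP) => // x Dx.
  case: ifPn => // _.
  elim: (n) x Dx {IH} => [|k IH] x Dx //=.
  by apply: (op_ge0 PP) => // z Dz; case: ifPn => // _; exact: IH.
case: ifPn => [_|]; first by rewrite lee_fin mulr_ge0 ?invr_ge0 ?powR_ge0.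
by rewrite -ltNge => Mx; rewrite addSnnS; exact: IH.
Qed.

Lemma iter_taboo_ge0 n f y : (forall x, D x -> 0 <= f x)%E -> D y ->
  (0 <= iter n taboo f y)%E.
Proof.
move=> f0; elim: n y => [|n IH] y Dy /=; first exact: f0.
by apply: (op_ge0 PP) => // x Dx; case: ifPn => // _; exact: IH.
Qed.

(** The start may lie in [G], where no drift is available: the first step is paid by [PV_le], and
    the bound outside [G] with [m = 0] takes over. *)
Lemma taboo_tail : exists A : R, 1 <= A /\ forall n y, D y ->
  (iter n taboo (fun=> 1) y <= (A * Num.max 1 (V y) * (n.+1%:R `^ b)^-1)%:E)%E.
Proof.
have CV0 := CV_ge0.
have kb0 : 0 < (kap / 2) `^ b by rewrite powR_gt0// divr_gt0.
have kb1 : (kap / 2) `^ b <= 1.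
  have k0 := kap_gt0; have k1 := kap_le1.
  have := @ge0_ler_powR R b (ltW b_gt0) (kap / 2) 1.
  by rewrite !nnegrE powR1; apply; lra.
(* The half comes from [n + 1 >= (n + 2)/2], as one step has been spent; [1 + CV] covers both
   [n = 0] and the first step. *)
exists ((1 + CV) / (kap / 2) `^ b); split.
  rewrite ler_pdivlMr// mul1r.
  by apply: (le_trans kb1); lra.
move=> [|n] y Dy; set m := Num.max _ _.
  have m1 : 1 <= m by rewrite le_max lexx.
  rewrite /= lee_fin powR1 invr1 mulr1 -[leLHS]mulr1.
  apply: ler_pM => //.
  rewrite ler_pdivlMr// mul1r.
  by apply: (le_trans kb1); lra.
pose r := ((kap * n.+1%:R) `^ b)^-1.
have r0 : 0 <= r by rewrite invr_ge0 powR_ge0.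
apply: (@le_trans _ _ (r%:E * P (fun x => (V x)%:E) y)%E).
  rewrite /= {1}/taboo -(opZ PP r0 nice_V Dy).
  apply: (op_le PP) => // x Dx.
    by case: ifPn => // _; exact: iter_taboo_ge0.
  case: ifPn => [_|]; first by rewrite -EFinM lee_fin mulr_ge0// V_ge0.
  rewrite -ltNge => Mx.
  apply: (le_trans (taboo_tail_out n 0 Dx Mx)); rewrite addn0 /hV mulr0 addr0.
  by rewrite -powRrM mulVf ?gt_eqF// powRr1 ?V_ge0// -EFinM.
apply: (@le_trans _ _ (r%:E * (CV * V y)%:E)%E).
  by rewrite lee_wpmul2l ?lee_fin//; exact: PV_le.
rewrite -EFinM lee_fin.
have Vm : CV * V y <= (1 + CV) * m.
  have : V y <= m by rewrite le_max lexx orbT.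
  have := V_ge0 Dy => ? ?; nra.
have rle : r <= ((kap / 2) `^ b)^-1 * (n.+2%:R `^ b)^-1.
  rewrite -invfM -powRM//; last by rewrite divr_ge0// ltW.
  rewrite lef_pV2 ?posrE ?powR_gt0 ?mulr_gt0 ?divr_gt0//.
  have k0 := kap_gt0.
  apply: ge0_ler_powR; rewrite ?nnegrE ?mulr_ge0 ?divr_ge0//; try exact: ltW.
  rewrite -mulrA ler_pM2l//.
  rewrite -[n.+2]addn2 -[n.+1]addn1 !natrD.
  have : 0 <= n%:R :> R by [].
  lra.
rewrite [leRHS](_ : _ = ((kap / 2) `^ b)^-1 * (n.+2%:R `^ b)^-1 * ((1 + CV) * m)); last by ring.
by apply: ler_pM => //; rewrite mulr_ge0// V_ge0.
Qed.

(** * Mean of [W] at the return to [G] *)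

Definition return_term k : T -> \bar R :=
  iter k taboo (P (fun y => if V y <= M0 then (W y)%:E else 0%E)).

Let nice0 : nice (fun=> 0%E). Proof. exact: (nice_cst PP). Qed.

Let nice_iter_taboo k f : nice f -> nice (iter k taboo f).
Proof.
by move=> nf; elim: k => //= k IH; apply: (nice_op PP); exact: nice_if.
Qed.

Lemma nice_return k : nice (return_term k).
Proof. by apply: nice_iter_taboo; apply: (nice_op PP); exact: nice_if. Qed.

(** The mean of [W] at the return to [G] on the event [T_1 <= l]. Finite [l] keeps every argument an
    induction over steps. *)
Definition return_sum l y := (\sum_(0 <= j < l) return_term j y)%E.

Lemma nice_return_sum l : nice (return_sum l).
Proof.
elim: l => [|l IH].
  by rewrite (_ : return_sum 0 = fun=> 0%E)//; apply/funext => y; rewrite /return_sum big_geq.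
rewrite (_ : return_sum l.+1 = fun y => return_sum l y + return_term l y)%E.
  exact: (niceD PP IH (nice_return l)).
by apply/funext => y; rewrite /return_sum big_nat_recr.
Qed.

(** First-step decomposition: the step either lands in [G] and collects [W], or leaves at most [l]
    further steps to return. *)
Lemma return_sumS l y : D y ->
  return_sum l.+1 y = P (fun x => if V x <= M0 then (W x)%:E else return_sum l x) y.
Proof.
move=> Dy; rewrite /return_sum big_nat_recl//.
have nQ j : nice (fun x => if V x <= M0 then 0%E else return_term j x).
  by apply: nice_if => //; exact: nice_return.
have [nS eS] := @op_sum (fun j x => if V x <= M0 then 0%E else return_term j x) l y nQ Dy.
have -> : (\sum_(0 <= i < l) return_term i.+1 y =
  P (fun x => \sum_(0 <= j < l) (if (V x <= M0)%R then 0 else return_term j x)) y)%E by rewrite eS.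
rewrite -(opD PP)//; last exact: nice_if.
congr (P _ y); apply/funext => x; case: ifPn => _.
  by rewrite big1 ?adde0.
by rewrite add0e.
Qed.

Let alpha_powR v : M0 < v -> 1 <= v `^ (1 - b^-1).
Proof.
have M01 := M0_gt1.
move=> Mv; rewrite -[leLHS](powRr0 v) ler_powR//; first lra.
by rewrite subr_ge0 invf_le1// ltW.
Qed.

(** [W + (BW/c0) V] is a supersolution outside [G]: a step adds at most [BW] to the mean of [W],
    while [V] loses at least [c0] because [V^(1-1/b) >= 1] there. *)
Lemma return_sum_le_out l y : D y -> M0 < V y ->
  (return_sum l y <= (W y + BW / c0 * V y)%:E)%E.
Proof.
have A0 : 0 <= BW / c0 by rewrite divr_ge0// ltW.
elim: l y => [|l IH] y Dy My.
  by rewrite /return_sum big_geq// lee_fin addr_ge0 ?W_ge0// mulr_ge0// V_ge0.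
rewrite return_sumS//.
apply: (@le_trans _ _ (P (fun x => (W x)%:E + (BW / c0)%:E * (V x)%:E) y)%E).
  apply: (op_le PP) => // x Dx.
    case: ifPn => _; first by rewrite lee_fin W_ge0.
    by apply: (nice_ge0 PP) Dx; exact: nice_return_sum.
  case: ifPn => [_|]; first by rewrite leeDl// -EFinM lee_fin mulr_ge0// V_ge0.
  by rewrite -ltNge => Mx; rewrite -EFinM -EFinD; exact: IH.
rewrite (opD PP nice_W (niceZ PP A0 nice_V))// (opZ PP A0 nice_V)//.
apply: (@le_trans _ _ ((W y + BW)%:E + (BW / c0)%:E * (V y - c0 * V y `^ (1 - b^-1))%:E)%E).
  apply: leeD; first exact: PW_le.
  by apply: lee_wpmul2l; rewrite ?lee_fin//; exact: drift_V.
rewrite -EFinM -EFinD lee_fin mulrBr.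
have -> : BW / c0 * (c0 * V y `^ (1 - b^-1)) = BW * V y `^ (1 - b^-1).
  by field; rewrite gt_eqF.
have := alpha_powR My; move: BW_ge0 => ? ?; nra.
Qed.

(** One step controlled by [PW_le] and [PV_le] reduces an arbitrary start to the bound outside
    [G]. *)
Lemma return_sum_le l y : D y ->
  (return_sum l y <= (W y + BW + BW / c0 * (CV * V y))%:E)%E.
Proof.
have A0 : 0 <= BW / c0 by rewrite divr_ge0// ltW.
move=> Dy; case: l => [|l].
  by rewrite /return_sum big_geq// lee_fin !addr_ge0 ?W_ge0// !mulr_ge0// ?V_ge0// invr_ge0 ltW.
rewrite return_sumS//.
apply: (@le_trans _ _ (P (fun x => (W x)%:E + (BW / c0)%:E * (V x)%:E) y)%E).
  apply: (op_le PP) => // x Dx.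
    case: ifPn => _; first by rewrite lee_fin W_ge0.
    by apply: (nice_ge0 PP) Dx; exact: nice_return_sum.
  case: ifPn => [_|]; first by rewrite leeDl// -EFinM lee_fin mulr_ge0// V_ge0.
  by rewrite -ltNge => Mx; rewrite -EFinM -EFinD; exact: return_sum_le_out.
rewrite (opD PP nice_W (niceZ PP A0 nice_V))// (opZ PP A0 nice_V)//.
rewrite (EFinD (W y + BW)) leeD//; first exact: PW_le.
by rewrite (EFinM (BW / c0)) lee_wpmul2l ?lee_fin//; exact: PV_le.
Qed.

(** * Successive excursions that miss the core *)

Definition avoid n : T -> \bar R :=
  iter n (fun u => P (fun y => if (V y <= M0) && (W y <= M1) then 0%E else u y))
    (fun=> 1%E).

Let avoid_ge0 n y : D y -> (0 <= avoid n y)%E.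
Proof.
elim: n y => //= n IH y Dy.
by apply: (op_ge0 PP) => // x Dx; case: ifPn => // _; exact: IH.
Qed.

Let avoid_le1 n y : D y -> (avoid n y <= 1)%E.
Proof.
elim: n y => //= n IH y Dy; apply: le_trans (op1 PP Dy).
apply: (op_le PP) => // x Dx; case: ifPn => // _; first exact: avoid_ge0.
exact: IH.
Qed.

Variable rho : R.
Hypothesis rho_ge0 : 0 <= rho.
Hypothesis return_contr : forall l y, D y -> V y <= M0 -> M1 < W y ->
  (return_sum l y <= (rho * W y)%:E)%E.
Hypothesis M1_gt1 : 1 < M1.

(** Decomposition at the first return to [G]. Either it takes more than [l] steps, or it occurs with
    at least [k L] steps left, and the assumed bound is averaged over the place of return, which
    turns [W] into [return_sum]. *)
Lemma avoid_excursion (k L : nat) (e : R) : 0 <= e ->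
  (forall n y, D y -> V y <= M0 -> M1 < W y -> (k * L <= n)%N ->
    (avoid n y <= (rho ^+ k * W y + e)%:E)%E) ->
  forall l n y, D y -> (k * L + l <= n)%N ->
    (avoid n y <= iter l taboo (fun=> 1) y + (rho ^+ k)%:E * return_sum l y + e%:E)%E.
Proof.
move=> e0 IH; have rk0 : 0 <= rho ^+ k by exact: exprn_ge0.
elim=> [|l IHl] n y Dy.
  move=> _; rewrite /= /return_sum big_geq// mule0 adde0.
  apply: (le_trans (avoid_le1 n Dy)); by rewrite leeDl// lee_fin.
case: n => [|n]; first by rewrite addnS.
rewrite addnS ltnS => kln.
have n1 : nice (fun x => if V x <= M0 then 0%E else iter l taboo (fun=> 1%E) x).
  by apply: nice_if => //; apply: nice_iter_taboo; exact: (nice_cst PP).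
have n2 : nice (fun x => if V x <= M0 then (W x)%:E else return_sum l x).
  by apply: nice_if => //; exact: nice_return_sum.
have n12 := niceD PP n1 (niceZ PP rk0 n2).
pose F x := ((if (V x <= M0)%R then 0 else iter l taboo (fun=> 1) x) +
  (rho ^+ k)%:E * (if (V x <= M0)%R then (W x)%:E else return_sum l x))%E.
have nF : nice F by exact: n12.
apply: (@le_trans _ _ (P (fun x => 1%:E * F x + e%:E)%E y)).
  apply: (op_le PP) => // x Dx.
    by case: ifPn => // _; exact: avoid_ge0.
  (* A point of [G] is either in the core, where nothing is left to bound, or has [W > M1], where
     the bound over [k] blocks applies. *)
  rewrite mul1e /F; case: (boolP (V x <= M0)) => /= [VM|]; last first.
    by rewrite -ltNge => VM; exact: IHl.
  rewrite add0e -EFinM -EFinD; case: ifPn => [_|].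
    by rewrite lee_fin addr_ge0// mulr_ge0// W_ge0.
  rewrite -ltNge => WM; apply: IH => //.
  by rewrite (leq_trans _ kln)// leq_addr.
apply: (le_trans (op_affine_le nF ler01 e0 Dy)) => //.
by rewrite mul1e (opD PP n1 (niceZ PP rk0 n2))// (opZ PP rk0 n2)// return_sumS.
Qed.

(** Each block of [L] steps costs [d] for a long excursion and otherwise multiplies the mean of [W]
    by [rho]. With no block left the bound is [W y > M1 > 1], hence trivial. *)
Lemma avoid_core (L : nat) (d : R) : 0 <= d ->
  (forall y, D y -> V y <= M0 -> (iter L taboo (fun=> 1) y <= d%:E)%E) ->
  forall k n y, D y -> V y <= M0 -> M1 < W y -> (k * L <= n)%N ->
    (avoid n y <= (rho ^+ k * W y + k%:R * d)%:E)%E.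
Proof.
have M11 := M1_gt1.
move=> d0 tail; elim=> [|k IH] n y Dy Vy Wy.
  move=> _; rewrite expr0 mul1r mul0r addr0.
  apply: (le_trans (avoid_le1 n Dy)); rewrite lee_fin; lra.
rewrite mulSn addnC => kLn.
have kd0 : 0 <= k%:R * d by exact: mulr_ge0.
apply: (le_trans (avoid_excursion kd0 IH Dy kLn)).
have rk0 : 0 <= rho ^+ k by exact: exprn_ge0.
apply: (@le_trans _ _ (d%:E + (rho ^+ k)%:E * (rho * W y)%:E + (k%:R * d)%:E)%E).
  rewrite leeD2r// leeD//; first exact: tail.
  by rewrite lee_wpmul2l ?lee_fin//; exact: return_contr.
rewrite -EFinM -!EFinD lee_fin le_eqVlt; apply/orP; left; apply/eqP.
by rewrite exprSr -(addn1 k) natrD; ring.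
Qed.

(** One block brings an arbitrary start back to [G], and [k] contracting blocks follow; hence [k.+1]
    blocks but only [rho ^+ k]. *)
Lemma avoid_le : exists C1 : R, 0 <= C1 /\ forall (k L n : nat) y, D y ->
  (k.+1 * L <= n)%N ->
  (avoid n y <= (C1 * (Num.max 1 (W y) + Num.max 1 (V y)) *
     (rho ^+ k + k.+1%:R * (L.+1%:R `^ b)^-1))%:E)%E.
Proof.
have M01 := M0_gt1; have BW0 := BW_ge0; have CV0 := CV_ge0.
have [A [A1 tail]] := taboo_tail.
have A0 : 0 <= BW / c0 by rewrite divr_ge0// ltW.
(* [A * M0] bounds the tail coefficient on [G], where [max(1, V) <= M0]; the other terms bound the
   mean of [W] at the first return. *)
set C1 := A * M0 + 1 + BW + BW / c0 * CV.
have ACV0 : 0 <= BW / c0 * CV by exact: mulr_ge0.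
have AM0 : A <= A * M0 by nra.
exists C1; split; first by rewrite /C1; lra.
move=> k L n y Dy; rewrite mulSn addnC => kLn.
set q := (L.+1%:R `^ b)^-1.
have q0 : 0 <= q by rewrite invr_ge0 powR_ge0.
have d0 : 0 <= A * M0 * q by rewrite !mulr_ge0//; lra.
have tailG x : D x -> V x <= M0 -> (iter L taboo (fun=> 1) x <= (A * M0 * q)%:E)%E.
  move=> Dx Vx; apply: (le_trans (tail L x Dx)); rewrite lee_fin ler_wpM2r//.
  rewrite ler_wpM2l//; first lra.
  by rewrite ge_max Vx andbT ltW.
have kd0 : 0 <= k%:R * (A * M0 * q) by exact: mulr_ge0.
apply: (le_trans (avoid_excursion kd0 (@avoid_core L _ d0 tailG k) Dy kLn)).
have rk0 : 0 <= rho ^+ k by exact: exprn_ge0.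
apply: (@le_trans _ _ ((A * Num.max 1 (V y) * q)%:E +
  (rho ^+ k)%:E * (W y + BW + BW / c0 * (CV * V y))%:E + (k%:R * (A * M0 * q))%:E)%E).
  rewrite leeD2r// leeD//; first exact: tail.
  by rewrite lee_wpmul2l ?lee_fin//; exact: return_sum_le.
rewrite -EFinM -!EFinD lee_fin.
set w := Num.max 1 (W y); set v := Num.max 1 (V y).
have w1 : 1 <= w by rewrite le_max lexx.
have v1 : 1 <= v by rewrite le_max lexx.
have Ww : W y <= w by rewrite le_max lexx orbT.
have Vv : V y <= v by rewrite le_max lexx orbT.
have C1w : W y + BW + BW / c0 * (CV * V y) <= C1 * (w + v).
  rewrite mulrA; have := V_ge0 Dy; have := W_ge0 Dy; rewrite /C1.
  move: (BW / c0 * CV) ACV0 BW_ge0 => x x0 bw0 W0' V0'.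
  have : x * V y <= x * v by exact: ler_wpM2l.
  have : 0 <= A * M0 by lra.
  move: (A * M0) => am ? ?; nra.
have C1A : A * v * q + k%:R * (A * M0 * q) <= C1 * (w + v) * (k.+1%:R * q).
  have -> : C1 * (w + v) * (k.+1%:R * q) =
      k%:R * (C1 * (w + v) * q) + C1 * (w + v) * q by rewrite -(addn1 k) natrD; ring.
  have AC : A * M0 <= C1 by rewrite /C1; lra.
  have C10 : 0 <= C1 by lra.
  rewrite addrC; apply: lerD.
    rewrite ler_wpM2l// ler_wpM2r// (le_trans AC)// ler_peMr//; lra.
  by rewrite ler_wpM2r// ler_pM//; lra.
have := ler_wpM2l rk0 C1w.
lra.
Qed.

End drift.

(** * Choice of the number and length of the blocks *)

(** With [lam = - ln rho], apply [ln z <= z] to [z = (lam/q) (k+1)]: multiplied by [q], it compares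
    [q ln (k+1)] with [lam k] up to a constant. *)
Lemma geometric_le_powR (R : realType) (q rho : R) : 0 < q -> 0 < rho < 1 ->
  exists C : R, 0 <= C /\ forall k : nat, rho ^+ k <= C * k.+1%:R `^ (- q).
Proof.
move=> q0 /andP[r0 r1].
pose lam := - ln rho.
have lam0 : 0 < lam by rewrite oppr_gt0 ln_lt0// r0.
pose mu := lam / q.
have mu0 : 0 < mu by exact: divr_gt0.
exists (expR (lam - q * ln mu)); split; first exact: expR_ge0.
move=> k.
have k0 : (0 : R) < k.+1%:R by [].
rewrite /powR gt_eqF// -expRD.
have -> : rho ^+ k = expR (- lam * k%:R).
  by rewrite /lam opprK expRM_natr lnK.
rewrite ler_expR.
have : ln (mu * k.+1%:R) <= mu * k.+1%:R.
  have m0 : 0 < mu * k.+1%:R by exact: mulr_gt0.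
  by rewrite -ler_expR lnK// (le_trans _ (expR_ge1Dx _))// lerDr.
rewrite lnM ?posrE// => h.
have := ler_wpM2l (ltW q0) h.
have -> : q * (mu * k.+1%:R) = lam * k%:R + lam.
  by rewrite /mu -(addn1 k) natrD; field; rewrite gt_eqF.
by lra.
Qed.

Lemma block_choice (R : realType) (b eps rho : R) : 1 < b -> 0 < eps -> 0 < rho < 1 ->
  exists C : R, 0 <= C /\ forall n : nat, (1 <= n)%N ->
  exists k L : nat, (k.+1 * L <= n)%N /\
    rho ^+ k + k.+1%:R * (L.+1%:R `^ b)^-1 <= C * n%:R `^ (- (b - eps)).
Proof.
move=> b1 e0 r01.
have b0 : 0 < b by lra.
(* With [k] of order [n^s] and [L] of order [n^(1-s)], the term [k L^(-b)] has order
   [n^(-b + s(1+b))], so [s (1+b) = eps] is the right choice. *)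
pose s := eps / (b + 1).
have s0 : 0 < s by rewrite divr_gt0//; lra.
have sb : s + s * b = eps by rewrite /s; field; rewrite gt_eqF//; lra.
(* The exponent [b/s] makes [rho^k] at most a multiple of [(n^s)^(-b/s) = n^(-b)]. *)
have [C [C0 HC]] := @geometric_le_powR R (b / s) rho (divr_gt0 b0 s0) r01.
(* One factor comes from [k + 1 <= 2 t], the other from [L + 1 >= n/(2t)] raised to the power
   [-b]. *)
pose C' := 2 * 2 `^ b.
have C'0 : 0 <= C' by rewrite mulr_ge0// powR_ge0.
exists (C + C'); split; first exact: addr_ge0.
move=> n n1.
have n1' : 1 <= n%:R :> R by rewrite ler1n.
have n0 : 0 < n%:R :> R by lra.
pose t := n%:R `^ s.
have t1 : 1 <= t by rewrite /t -[leLHS](powRr0 n%:R) ler_powR// ltW.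
have t0 : 0 < t by lra.
pose k := Num.trunc t.
have [kt tk] : k%:R <= t /\ t < k.+1%:R.
  by have /andP[] := truncn_itv (ltW t0).
pose L := (n %/ k.+1)%N.
exists k, L; split; first by rewrite mulnC leq_trunc_div.
have Ln : (n%:R : R) < k.+1%:R * L.+1%:R.
  by rewrite -natrM ltr_nat mulnC ltn_ceil.
have k2 : k.+1%:R <= 2 * t by rewrite -addn1 natrD; lra.
have L0 : 0 < L.+1%:R :> R by [].
rewrite mulrDl; apply: lerD.
  apply: (le_trans (HC k)); rewrite ler_wpM2l//.
  apply: (@le_trans _ _ (n%:R `^ (- b))); last first.
    by rewrite ler_powR//; lra.
  rewrite !powRN lef_pV2 ?posrE ?powR_gt0//.
  have -> : b = s * (b / s) by field; rewrite gt_eqF.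
  rewrite powRrM (_ : s * (b / s) / s = b / s); last by field; rewrite gt_eqF.
  apply: ge0_ler_powR; rewrite ?nnegrE//; try exact: ltW.
  by rewrite divr_ge0// ltW.
have LL : (n%:R / (2 * t)) <= L.+1%:R.
  rewrite ler_pdivrMr ?mulr_gt0//.
  by apply: (le_trans (ltW Ln)); rewrite mulrC ler_wpM2l// ltW.
have nt0 : 0 < n%:R / (2 * t) by rewrite divr_gt0// mulr_gt0.
apply: (@le_trans _ _ (2 * t * ((n%:R / (2 * t)) `^ b)^-1)).
  have i0 : 0 <= (L.+1%:R `^ b)^-1 by rewrite invr_ge0 powR_ge0.
  apply: ler_pM (ler0n _ _) i0 k2 _.
  rewrite lef_pV2 ?posrE ?powR_gt0//.
  by apply: ge0_ler_powR; rewrite ?nnegrE// ltW.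
have i0 : 0 <= (2 * t)^-1 by rewrite invr_ge0 mulr_ge0// ltW.
have h2t : 0 <= 2 * t by rewrite mulr_ge0// ltW.
have e2 : (2 * t)^-1 `^ b = ((2 * t) `^ b)^-1.
  by rewrite -(powR_inv1 h2t) -powRrM mulN1r powRN.
rewrite (powRM _ (ltW n0) i0) e2 invfM invrK -powRN.
have t2 : 0 <= 2 :> R by [].
rewrite (powRM _ t2 (ltW t0)) /t -powRrM.
rewrite [leLHS](_ : _ = C' * (n%:R `^ s * n%:R `^ (s * b) * n%:R `^ (- b))); last first.
  by rewrite /C'; ring.
rewrite -!powRD ?(gt_eqF n0) ?implybT//.
by rewrite sb opprB.
Qed.

(** * Integrals over the unit interval and against exponential laws *)

(** The integral of a nonnegative function is a supremum over simple functions below it, and this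
    supremum is monotone without measurability. It lets [op_le] compare functions outside the class
    [nice], such as [avoid]. *)
Lemma ge0_le_integral_nonmeas d (T : measurableType d) (R : realType)
    (m : {measure set T -> \bar R}) (D : set T) (f g : T -> \bar R) :
  (forall x, D x -> 0 <= f x)%E -> (forall x, D x -> f x <= g x)%E ->
  (\int[m]_(x in D) f x <= \int[m]_(x in D) g x)%E.
Proof.
move=> f0 fg.
have g0 x : D x -> (0 <= g x)%E by move=> Dx; exact: le_trans (f0 _ Dx) (fg _ Dx).
rewrite [leLHS]integral_mkcond [leRHS]integral_mkcond.
rewrite !ge0_integralTE//; try by apply: erestrict_ge0.
apply: ge_ereal_sup => _ [h hf <-]; apply: ereal_sup_ubound.
exists h => // x; apply: (le_trans (hf x)).
by rewrite !patchE; case: ifPn => // /set_mem; exact: fg.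
Qed.

Section integrals.
Variable R : realType.
Notation mu := (@lebesgue_measure R).

(** For negative [g] the integrand is singular at 0, so the antiderivative [x^(g+1)/(g+1)] is used
    on [[a, 1]], with a bound uniform in [a]. *)
Lemma integral_powR_away (g a : R) : -1 < g -> 0 < a < 1 ->
  (\int[mu]_(x in `[a, 1%R]) (x `^ g)%:E <= ((g + 1)^-1)%:E)%E.
Proof.
move=> g1 /andP[a0 a1].
have g10 : 0 < g + 1 by lra.
have inpos (x : R) : 0 < x -> x \in `]0, +oo[ by move=> x0; rewrite in_itv/= x0.
pose F (x : R) := (g + 1)^-1 * x `^ (g + 1).
have dF (x : R) : 0 < x -> is_derive x 1 F (x `^ g).
  move=> x0.
  have := @is_derive1_powR R (g + 1) x x0 => d.
  have -> : x `^ g = (g + 1)^-1 *: ((g + 1) * x `^ (g + 1 - 1)).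
    by rewrite addrK /GRing.scale /= mulrA mulVf ?gt_eqF// mul1r.
  exact: is_deriveZ.
have cF (x : R) : 0 < x -> {for x, continuous F}.
  move=> x0; apply: differentiable_continuous.
  by apply/derivable1_diffP; have [] := dF x x0.
have cf (x : R) : 0 < x -> {for x, continuous (fun x => x `^ g)}.
  move=> x0; apply: differentiable_continuous.
  by apply/derivable1_diffP; apply: derivable_powR; exact: inpos.
rewrite (@continuous_FTC2 _ (fun x => x `^ g) F)//.
- rewrite -EFinB lee_fin /F powR1 mulr1 gerBl mulr_ge0 ?powR_ge0// invr_ge0.
  exact: ltW.
- apply: continuous_in_subspaceT => x; rewrite inE/= in_itv/= => /andP[ax _].
  by apply: cf; lra.
- split.
  + move=> x; rewrite in_itv/= => /andP[ax _].
    by have [] := dF x (lt_trans a0 ax).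
  + by apply: cvg_at_right_filter; exact: cF.
  + by apply: cvg_at_left_filter; exact: cF.
- move=> x; rewrite in_itv/= => /andP[ax _].
  by rewrite derive1E; have [_] := dF x (lt_trans a0 ax).
Qed.

(** Monotone convergence along compact intervals that avoid both endpoints. *)
Lemma unif_int_le_exhaust (f : R -> \bar R) (c : \bar R) :
  measurable_fun (`]0, 1[%classic : set R) f -> (forall x, (0 < x < 1)%R -> 0 <= f x)%E ->
  (forall a, (0 < a < 1/2)%R -> \int[mu]_(x in `[a, (1 - a)%R]) f x <= c)%E ->
  (unif_int f <= c)%E.
Proof.
move=> mf f0 fc.
(* The shift by 3 keeps [e n] below 1/2 from [n = 0] on. *)
pose e (n : nat) : R := (n.+3%:R)^-1.
have e0 n : 0 < e n by rewrite invr_gt0.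
have e1 n : e n < 1/2.
  by rewrite div1r ltf_pV2 ?posrE// ltr_nat.
pose F n := `[e n, (1 - e n)%R]%classic.
have Fsub n : F n `<=` `]0%R, 1%R[.
  move=> x; rewrite /F /= !in_itv/= => /andP[ex xe].
  have := e0 n; have := e1 n; lra.
have UF : \bigcup_n F n = `]0%R, 1%R[%classic.
  apply/seteqP; split; first by move=> x [n _] /Fsub.
  move=> x; rewrite /= in_itv/= => /andP[x0 x1].
  pose m := Num.min x (1 - x).
  have m0 : 0 < m by rewrite lt_min x0/=; lra.
  exists (Num.trunc m^-1) => //.
  have em : e (Num.trunc m^-1) <= m.
    rewrite /e invf_ple ?posrE//.
    have /andP[_ h] := truncn_itv (ltW (eqbRL (invr_gt0 m) m0)).
    apply: (le_trans (ltW h)); rewrite ler_nat.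
    exact: leq_trans (leqnSn _) (leqnSn _).
  have : m <= x by rewrite ge_min lexx.
  have : m <= 1 - x by rewrite ge_min lexx orbT.
  by rewrite /F /= in_itv/=; lra.
have ndF : nondecreasing_seq F.
  apply/nondecreasing_seqP => n; rewrite subsetEset => x.
  rewrite /F /= !in_itv/=.
  have : e n.+1 <= e n by rewrite lef_pV2 ?posrE// ler_nat.
  lra.
have mF n : measurable (F n) by exact: measurable_itv.
have mfF n : measurable_fun (F n) f.
  by apply: measurable_funS mf => //; exact: Fsub.
have f0F n x : F n x -> (0 <= f x)%E.
  by move=> /Fsub; rewrite /= in_itv/=; exact: f0.
rewrite /unif_int -UF.
have cv : (\int[mu]_(x in F i) f x @[i --> \oo] --> \int[mu]_(x in \bigcup_i F i) f x)%E.
  by have := ge0_nondecreasing_set_cvg_integral (mu:=mu) ndF mF mfF f0F; apply.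
rewrite -(cvg_lim _ cv)//; apply: lime_le; first by apply/cvg_ex; eexists; exact: cv.
by apply: nearW => n; apply: fc; rewrite e0 e1.
Qed.

Lemma unif_int_powR_le (g : R) : -1 < g ->
  (unif_int (fun p => (p `^ g)%:E) <= ((g + 1)^-1)%:E)%E.
Proof.
move=> g1; have mg : measurable_fun setT (fun p : R => (p `^ g)%:E).
  by apply/measurable_EFinP; exact: measurable_powR.
apply: unif_int_le_exhaust.
- exact: measurable_funTS.
- by move=> x _; rewrite lee_fin powR_ge0.
- move=> a /andP[a0 a1]; apply: le_trans (integral_powR_away g1 (a := a) _).
    apply: ge0_subset_integral => //; first exact: measurable_funTS.
      by move=> x _; rewrite lee_fin powR_ge0.
    by move=> x; rewrite /= !in_itv/=; lra.
  by lra.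
Qed.

Lemma unif_int_onem_powR_le (g : R) : -1 < g ->
  (unif_int (fun p => ((1 - p) `^ g)%:E) <= ((g + 1)^-1)%:E)%E.
Proof.
move=> g1; have mg : measurable_fun setT (fun p : R => ((1 - p) `^ g)%:E).
  apply/measurable_EFinP; apply: (measurableT_comp (measurable_powR _)).
  exact: measurable_funB.
apply: unif_int_le_exhaust.
- exact: measurable_funTS.
- by move=> x _; rewrite lee_fin powR_ge0.
- move=> a /andP[a0 a1]; apply: (le_trans _ (integral_powR_away g1 (a := a) _)); last lra.
  (* Enlarging the interval to [[0, 1 - a]] makes the substitution [x -> 1 - x] produce exactly
     [[a, 1]]. *)
  apply: (@le_trans _ _ (\int[mu]_(x in `[0%R, (1 - a)%R]) ((1 - x) `^ g)%:E)%E).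
    apply: ge0_subset_integral => //; first exact: measurable_funTS.
      by move=> x _; rewrite lee_fin powR_ge0.
    by move=> x; rewrite /= !in_itv/=; lra.
  rewrite (@integration_by_substitution_onem R (fun x => (1 - x) `^ g)).
  + have -> : unstable.onem (1 - a) = a by rewrite /unstable.onem; ring.
    rewrite le_eqVlt; apply/orP; left; apply/eqP; apply: eq_integral => x _.
    by congr (_%:E); congr (_ `^ _); rewrite /unstable.onem; ring.
  + by lra.
  + apply: continuous_in_subspaceT => x; rewrite inE/= in_itv/= => /andP[_ xa].
    apply: (@continuous_comp _ _ _ (fun x : R => 1 - x) (fun y : R => y `^ g) x).
      by apply: cvgB; [exact: cvg_cst|exact: cvg_id].
    apply: differentiable_continuous.
    apply/derivable1_diffP; apply: derivable_powR.
    by rewrite in_itv/= andbT; lra.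
Qed.

Lemma unif_int_cst (c : R) : unif_int (fun=> c%:E) = c%:E.
Proof.
rewrite /unif_int integral_cst//= lebesgue_measure_itv/= lte_fin ltr01.
by rewrite sube0 mule1.
Qed.

Lemma expo_int1_le (T : R) : 0 < T -> (expo_int T (fun=> 1) <= 1)%E.
Proof.
move=> T0; have Ti0 : 0 < T^-1 by rewrite invr_gt0.
rewrite -[leRHS](integral_exponential_pdf Ti0) /expo_int.
apply: (@le_trans _ _ (\int[mu]_(x in `]0%R, +oo[) (exponential_pdf T^-1 x)%:E)%E).
  rewrite le_eqVlt; apply/orP; left; apply/eqP; apply: eq_integral => x.
  rewrite inE/= in_itv/= andbT => x0.
  by rewrite mule1 exponential_pdfE ?ltW// mulNr (mulrC _ x).
apply: ge0_subset_integral => //.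
  by apply/measurable_EFinP; exact: measurable_exponential_pdf.
by move=> x _; rewrite lee_fin exponential_pdf_ge0// ltW.
Qed.

Lemma measurable_expo_density (T : R) :
  measurable_fun setT (fun x : R => (T^-1 * expR (- (x / T)))%:E).
Proof.
apply/measurable_EFinP; apply: measurable_funM => //.
apply: (measurableT_comp (@measurable_expR R)).
by apply: measurableT_comp => //; exact: measurable_funM.
Qed.

(** With [z = x/(2T)], the bound [z exp(-z) <= 1] dominates [x] times the density of mean [T] by
    [4T] times the density of mean [2T]. Only the total mass of exponential laws is then needed. *)
Lemma expo_int_affine_le (T c : R) : 0 < T -> 0 <= c ->
  (expo_int T (fun x => (x + c)%:E) <= (c + 4 * T)%:E)%E.
Proof.
move=> T0 c0; have T20 : 0 < 2 * T by lra.
pose f (S x : R) := (S^-1 * expR (- (x / S)))%:E.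
have f0 S x : 0 < S -> (0 <= f S x)%E.
  by move=> S0; rewrite lee_fin mulr_ge0 ?expR_ge0// invr_ge0 ltW.
have mf S : measurable_fun (`]0, +oo[%classic : set R) (f S).
  by apply: measurable_funTS; exact: measurable_expo_density.
pose h x := (c%:E * f T x + (4 * T)%R%:E * f (2 * T)%R x)%E.
apply: (@le_trans _ _ (\int[mu]_(x in `]0%R, +oo[) h x)%E).
  apply: ge0_le_integral_nonmeas => x; rewrite /= in_itv/= andbT => x0.
    by rewrite mule_ge0 ?f0// lee_fin; lra.
  rewrite /h /f -!EFinM -EFinD lee_fin.
  have -> : 4 * T * ((2 * T)^-1 * expR (- (x / (2 * T)))) = 2 * expR (- (x / (2 * T))).
    by field; rewrite gt_eqF.
  set z := x / (2 * T).
  have -> : x / T = z + z by rewrite /z; field; rewrite gt_eqF.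
  have -> : x = 2 * T * z by rewrite /z; field; rewrite gt_eqF.
  have ez : z * expR (- z) <= 1.
    by rewrite expRN ler_pdivrMr ?expR_gt0// mul1r (le_trans _ (expR_ge1Dx _))// lerDr.
  rewrite opprD expRD.
  have -> : T^-1 * (expR (- z) * expR (- z)) * (2 * T * z + c) =
    c * (T^-1 * (expR (- z) * expR (- z))) + 2 * expR (- z) * (z * expR (- z)).
    by field; rewrite gt_eqF.
  by rewrite lerD2l ler_piMr// mulr_ge0// expR_ge0.
have mg S k : measurable_fun (`]0, +oo[%classic : set R) (fun x => k%:E * f S x)%E.
  by apply: measurable_funeM; exact: mf.
have g0 S k : 0 < S -> 0 <= k -> forall x : R, `]0, +oo[%classic x -> (0 <= k%:E * f S x)%E.
  by move=> S0 k0 x _; rewrite mule_ge0 ?f0.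
have T40 : 0 <= 4 * T by lra.
rewrite /h (ge0_integralD mu _ (g0 _ _ T0 c0) (mg _ _) (g0 _ _ T20 T40) (mg _ _))//.
rewrite (ge0_integralZl_EFin mu _ (fun x _ => f0 T x T0) (mf T) c0)//.
rewrite (ge0_integralZl_EFin mu _ (fun x _ => f0 (2 * T) x T20) (mf _) T40)//.
have f1 S : 0 < S -> (\int[mu]_(x in `]0%R, +oo[) f S x <= 1)%E.
  move=> S0; apply: le_trans (expo_int1_le S0); rewrite /expo_int.
  by under [leRHS]eq_integral do rewrite mule1.
rewrite EFinD; apply: leeD.
  by rewrite -[leRHS]mule1 lee_wpmul2l ?lee_fin// f1.
by rewrite -[leRHS]mule1 lee_wpmul2l ?lee_fin ?f1.
Qed.

End integrals.

(** * Updates of the energies *)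

Section updates.
Variables (R : realType) (N : nat).
Implicit Types (E : state R N) (i j : nat) (p x : R).

Lemma Eat_ord E (k : 'I_N) : Eat E k = E k.
Proof. by rewrite /Eat valK. Qed.

Lemma Eat_ge0 E i : pos_state E -> 0 <= Eat E i.
Proof. by move=> E0; rewrite /Eat; case: insub => //= k; exact: ltW. Qed.

Lemma Eat_gt0 E i : pos_state E -> (i < N)%N -> 0 < Eat E i.
Proof. by move=> E0 iN; rewrite -[i]/(nat_of_ord (Ordinal iN)) Eat_ord. Qed.

Lemma upd2_ge E i p q (k : 'I_N) : pos_state E -> 0 <= q <= 1 -> q <= p -> q <= 1 - p ->
  q * E k <= upd2 E i p k.
Proof.
move=> E0 /andP[q0 q1] qp qp'; have ek := E0 k.
have e1 := Eat_ge0 i E0; have e2 := Eat_ge0 i.+1 E0.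
rewrite /upd2 /=; case: ifPn => [/eqP ki|_].
  by have := Eat_ord E k; rewrite ki => ->; nra.
case: ifPn => [/eqP ki|_]; last by nra.
by have := Eat_ord E k; rewrite ki => ->; nra.
Qed.

Lemma upd1_ge E i p x (k : 'I_N) : pos_state E -> 0 <= p <= 1 -> 0 <= x ->
  p * E k <= upd1 E i p x k.
Proof.
move=> E0 /andP[p0 p1] x0; have ek := E0 k.
rewrite /upd1 /=; case: ifPn => [/eqP ki|_]; last by nra.
by have := Eat_ord E k; rewrite ki => ->; nra.
Qed.

Lemma upd2_pos E i p : pos_state E -> 0 < p < 1 -> pos_state (upd2 E i p).
Proof.
move=> E0 /andP[p0 p1] k.
pose q := Num.min p (1 - p).
have q0 : 0 < q by rewrite lt_min p0 subr_gt0.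
have qp : q <= p by rewrite ge_min lexx.
have qp' : q <= 1 - p by rewrite ge_min lexx orbT.
apply: lt_le_trans (upd2_ge i (p := p) (q := q) k E0 _ qp qp'); last lra.
exact: mulr_gt0.
Qed.

Lemma upd1_pos E i p x : pos_state E -> 0 < p < 1 -> 0 < x -> pos_state (upd1 E i p x).
Proof.
move=> E0 /andP[p0 p1] x0 k.
apply: lt_le_trans (upd1_ge i (p := p) (x := x) k E0 _ (ltW x0)); last lra.
exact: mulr_gt0.
Qed.

Lemma Wf_upd2 E i p : (i < N.-1)%N -> Wf (upd2 E i p) = Wf E.
Proof.
move=> iN; have iN0 : (i < N)%N by lia.
have iN1 : (i.+1 < N)%N by lia.
pose k0 := Ordinal iN0; pose k1 := Ordinal iN1.
have k10 : k1 != k0 by rewrite -val_eqE /= gtn_eqF.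
have split2 (F : 'I_N -> R) :
    \sum_k F k = F k0 + F k1 + \sum_(k | (k != k0) && (k != k1)) F k.
  by rewrite (bigD1 k0)//= (bigD1 k1)//= addrA.
rewrite /Wf !split2; congr (_ + _).
  rewrite /upd2 /= eqxx gtn_eqF// eqxx -(Eat_ord E k0) -(Eat_ord E k1) /=; ring.
apply: eq_bigr => k /andP[kk0 kk1]; rewrite /upd2 /=.
move: kk0 kk1; rewrite -!val_eqE /= => /negPf -> /negPf ->//.
Qed.

Lemma Wf_upd1_le E i p x : pos_state E -> 0 < p < 1 -> 0 < x -> (i < N)%N ->
  Wf (upd1 E i p x) <= Wf E + x.
Proof.
move=> E0 /andP[p0 p1] x0 iN; pose k0 := Ordinal iN.
rewrite /Wf (bigD1 k0)//= [in leRHS](bigD1 k0)//= [leRHS]addrAC.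
apply: lerD.
  rewrite /upd1 /= eqxx -(Eat_ord E k0) /=; have := Eat_ge0 i E0; nra.
apply: ler_sum => k; rewrite -val_eqE /= => /negPf kk0.
by rewrite /upd1 /= kk0.
Qed.

Lemma Wf_ge0 E : pos_state E -> 0 <= Wf E.
Proof. by move=> E0; apply: sumr_ge0 => k _; exact: ltW. Qed.

Lemma Vf_ge0 eta E : 0 <= Vf eta E.
Proof. by apply: sumr_ge0 => m _; apply: sumr_ge0 => k _; exact: powR_ge0. Qed.

(** The lower bound 1/2 places every exponent [a_m eta - 1] of [V] above [eta/2 - 1 > -1], a power
    integrable at 0. *)
Lemma a_coef_itv (m : nat) : (0 < m <= N)%N -> 1/2 <= a_coef R N m <= 1.
Proof.
case: m => //= m mN; rewrite /a_coef /=.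
have h1 : 1 <= (2 : R) ^+ m by rewrite exprn_ege1// ler1n.
have h2 : (2 : R) ^+ m.+1 <= 2 ^+ N by rewrite ler_weXn2l// ler1n.
rewrite exprS in h2.
have N0 : 0 < (2 : R) ^+ N - 1 by lra.
have : ((2 : R) ^+ m - 1) / (2 ^+ N - 1) <= 1/2 by rewrite ler_pdivrMr//; lra.
have : 0 <= ((2 : R) ^+ m - 1) / (2 ^+ N - 1) by rewrite divr_ge0//; lra.
lra.
Qed.

Lemma powR_antitone (e x y : R) : e <= 0 -> 0 < x -> x <= y -> y `^ e <= x `^ e.
Proof.
move=> e0 x0 xy; have y0 := lt_le_trans x0 xy.
rewrite -(opprK e) (powRN _ (- e)) (powRN x (- e)) lef_pV2 ?posrE ?powR_gt0//.
by apply: ge0_ler_powR; rewrite ?nnegrE ?oppr_ge0// ltW.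
Qed.

(** All exponents of [V] lie in [[eta/2 - 1, 0]]: scaling the energies by [q <= 1] multiplies each
    term by [q^e], which is at most [q^(eta/2 - 1)]. *)
Lemma Vf_le_scale eta q E E' : 0 < eta < 1 -> pos_state E -> 0 < q <= 1 ->
  (forall k : 'I_N, q * E k <= E' k) ->
  Vf eta E' <= q `^ (eta / 2 - 1) * Vf eta E.
Proof.
move=> /andP[eta0 eta1] E0 /andP[q0 q1] EE'.
have q01 : 0 < q <= 1 by rewrite q0.
have EatE i : (i < N)%N -> q * Eat E i <= Eat E' i.
  by move=> iN; rewrite -[i]/(nat_of_ord (Ordinal iN)) !Eat_ord.
rewrite /Vf mulr_sumr big_nat_cond [leRHS]big_nat_cond.
apply: ler_sum => m; rewrite andbT => /andP[m0 mN].
rewrite mulr_sumr big_nat_cond [leRHS]big_nat_cond.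
apply: ler_sum => k; rewrite andbT => /andP[_ kN].
have /andP[am am'] : 1/2 <= a_coef R N m <= 1 by apply: a_coef_itv; lia.
set e := _ * eta - 1.
have e0 : e <= 0 by rewrite /e; nra.
have eg : eta / 2 - 1 <= e by rewrite /e; nra.
set S := \sum_(0 <= j < m) Eat E (k + j).
have S0 : 0 < S.
  rewrite /S big_ltn// ltr_pwDl//; first by apply: Eat_gt0 => //; lia.
  by apply: sumr_ge0 => j _; exact: Eat_ge0.
have SS : q * S <= \sum_(0 <= j < m) Eat E' (k + j).
  rewrite /S mulr_sumr big_nat_cond [leRHS]big_nat_cond.
  by apply: ler_sum => j; rewrite andbT => /andP[_ jm]; apply: EatE; lia.
apply: (le_trans (powR_antitone e0 (mulr_gt0 q0 S0) SS)).
rewrite powRM ?(ltW q0) ?(ltW S0)// ler_wpM2r ?powR_ge0//.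
exact: ger_powR.
Qed.

(** The scale is [min(p, 1 - p)]; the sum of the two powers bounds whichever of them applies. *)
Lemma Vf_upd2_le eta E i p : 0 < eta < 1 -> pos_state E -> 0 < p < 1 ->
  Vf eta (upd2 E i p) <=
  (p `^ (eta / 2 - 1) + (1 - p) `^ (eta / 2 - 1)) * Vf eta E.
Proof.
move=> eta01 E0 /andP[p0 p1].
have V0 := Vf_ge0 eta E.
have [pp|pp] := leP p (1 - p).
  apply: (@le_trans _ _ (p `^ (eta / 2 - 1) * Vf eta E)).
    apply: Vf_le_scale => // [|k]; first lra.
    by apply: upd2_ge => //; lra.
  by rewrite ler_wpM2r// lerDl powR_ge0.
apply: (@le_trans _ _ ((1 - p) `^ (eta / 2 - 1) * Vf eta E)).
  apply: Vf_le_scale => // [|k]; first lra.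
  by apply: upd2_ge => //; lra.
by rewrite ler_wpM2r// lerDr powR_ge0.
Qed.

Lemma Vf_upd1_le eta E i p x : 0 < eta < 1 -> pos_state E -> 0 < p < 1 -> 0 < x ->
  Vf eta (upd1 E i p x) <= p `^ (eta / 2 - 1) * Vf eta E.
Proof.
move=> eta01 E0 /andP[p0 p1] x0.
apply: Vf_le_scale => // [|k]; first lra.
by apply: upd1_ge => //; lra.
Qed.

End updates.

(** * The jump kernel and the semigroup *)

(** Tonelli's theorem. Replacing [p] by [a0] outside [A] means that [h] is only evaluated at
    parameters in [A], where updated states are positive. *)
Lemma measurable_param_integral d (T : measurableType d) (R : realType)
    (A : set R) (a0 : R) (h : T -> R -> \bar R) : measurable A -> A a0 ->
  (forall t p, A p -> 0 <= h t p)%E ->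
  measurable_fun [set: T * R] (fun z => h z.1 (if z.2 \in A then z.2 else a0)) ->
  measurable_fun [set: T] (fun t => \int[@lebesgue_measure R]_(p in A) h t p)%E.
Proof.
move=> mA Aa0 h0 mh.
pose F (z : T * R) : \bar R :=
  if z.2 \in A then h z.1 (if z.2 \in A then z.2 else a0) else 0%E.
have mmem : measurable_fun [set: T * R] (fun z => z.2 \in A).
  apply: (measurableT_comp (f := fun x : R => x \in A)) => //.
  by apply: (measurable_fun_bool true); rewrite setTI; rewrite (_ : _ @^-1` _ = A)//;
    apply/seteqP; split => x /=; [exact: set_mem|exact: mem_set].
have mF : measurable_fun setT F by exact: measurable_fun_ifT.
have F0 z : (0 <= F z)%E.
  by rewrite /F; case: (boolP (z.2 \in A)) => // /set_mem zA; exact: h0.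
have := measurable_fun_fubini_tonelli_F (m2 := @lebesgue_measure R) F mF F0.
congr measurable_fun; apply/funext => t.
rewrite /fubini_F [RHS]integral_mkcond; apply: eq_integral => x _.
by rewrite /F patchE /=; case: (boolP (x \in A)).
Qed.

Section kernel.
Variables (R : realType) (N : nat).
Notation st := (state R N).

Definition coord_measurable d (T : measurableType d) (g : T -> st) : Prop :=
  (forall t, pos_state (g t)) /\ forall i, measurable_fun [set: T] (fun t => g t i).

(* Measurability for the product sigma-algebra on the positive states, phrased
   through all measurable parametrisations. *)
Definition measurable_on_pos (f : st -> \bar R) : Prop :=
  (forall E, pos_state E -> 0 <= f E)%E /\
  forall d (T : measurableType d) (g : T -> st), coord_measurable g ->
    measurable_fun [set: T] (fun t => f (g t)).

(** Clamping with defaults 1/2 and 1 turns parameters of the open intervals into maps defined on all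
    of [R] that never leave them. *)
Let in01 (p : R) := if p \in `]0, 1[%classic then p else 1/2.
Let inpos (x : R) := if x \in `]0, +oo[%classic then x else 1.

Let in01P p : 0 < in01 p < 1.
Proof. by rewrite /in01; case: ifPn => [/set_mem|_]; rewrite /= ?in_itv/=; lra. Qed.

Let inposP x : 0 < inpos x.
Proof. by rewrite /inpos; case: ifPn => [/set_mem|_] //; rewrite /= in_itv/= andbT. Qed.

Let measurable_in (A : set R) a0 : measurable A ->
  measurable_fun [set: R] (fun x => if x \in A then x else a0).
Proof.
move=> mA; apply: measurable_fun_ifT => //.
apply: (measurable_fun_bool true); rewrite setTI (_ : _ @^-1` _ = A)//.
by apply/seteqP; split => x /=; [exact: set_mem|exact: mem_set].
Qed.

Lemma measurable_Eat d (T : measurableType d) (g : T -> st) i : coord_measurable g ->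
  measurable_fun [set: T] (fun t => Eat (g t) i).
Proof. by move=> [_ mg]; rewrite /Eat; case: insub => //= k; exact: mg. Qed.

Lemma coord_measurable_upd2 d (T : measurableType d) (g : T -> st) (q : T -> R) i :
  coord_measurable g -> measurable_fun [set: T] q -> (forall t, 0 < q t < 1) ->
  coord_measurable (fun t => upd2 (g t) i (q t)).
Proof.
move=> cg mq q01; split => [t|k]; first by apply: upd2_pos => //; exact: cg.1.
have mE j := measurable_Eat j cg.
rewrite /upd2 /=; case: (_ == i).
  by apply: measurable_funM => //; exact: measurable_funD.
case: (_ == i.+1); last exact: cg.2.
by apply: measurable_funM; [exact: measurable_funB|exact: measurable_funD].
Qed.

Lemma coord_measurable_upd1 d (T : measurableType d) (g : T -> st) (q x : T -> R) i :
  coord_measurable g -> measurable_fun [set: T] q -> (forall t, 0 < q t < 1) ->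
  measurable_fun [set: T] x -> (forall t, 0 < x t) ->
  coord_measurable (fun t => upd1 (g t) i (q t) (x t)).
Proof.
move=> cg mq q01 mx x0; split => [t|k]; first by apply: upd1_pos => //; exact: cg.1.
have mE j := measurable_Eat j cg.
rewrite /upd1 /=; case: (_ == i); last exact: cg.2.
by apply: measurable_funM => //; exact: measurable_funD.
Qed.

Lemma coord_measurable_comp d (T : measurableType d) d' (T' : measurableType d')
    (g : T -> st) (u : T' -> T) :
  coord_measurable g -> measurable_fun [set: T'] u -> coord_measurable (g \o u).
Proof.
move=> [g0 mg] mu; split => [t|k]; first exact: g0.
by apply: (measurableT_comp (mg k)).
Qed.

Lemma coord_measurable_cst d (T : measurableType d) (E : st) : pos_state E ->
  coord_measurable (fun _ : T => E).
Proof. by move=> E0; split. Qed.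

Definition exchange_op i (f : st -> \bar R) (E : st) : \bar R :=
  unif_int (fun p => f (upd2 E i p)).

Definition bath_op (Tb : R) i (f : st -> \bar R) (E : st) : \bar R :=
  unif_int (fun p => expo_int Tb (fun x => f (upd1 E i p x))).

Variables (f : st -> \bar R).
Hypothesis nf : measurable_on_pos f.

Lemma measurable_exchange i d (T : measurableType d) (g : T -> st) :
  coord_measurable g -> measurable_fun [set: T] (fun t => exchange_op i f (g t)).
Proof.
move=> cg; apply: (@measurable_param_integral _ _ _ _ (1/2)) => //.
- by rewrite /= in_itv/=; lra.
- move=> t p; rewrite /= in_itv/= => p01; apply: nf.1.
  by apply: upd2_pos => //; exact: cg.1.
- apply: nf.2; apply: (@coord_measurable_upd2 _ _ (g \o fst) (in01 \o snd)).
  + by apply: coord_measurable_comp.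
  + by apply: measurableT_comp => //; exact: measurable_in.
  + by move=> z; exact: in01P.
Qed.

Lemma measurable_exchange_integrand i (E : st) : pos_state E ->
  measurable_fun (`]0, 1[%classic : set R) (fun p => f (upd2 E i p)).
Proof.
move=> E0; apply: (eq_measurable_fun (fun p => f (upd2 E i (in01 p)))).
  by move=> p p01; rewrite /in01 p01.
apply: measurable_funTS; apply: nf.2.
apply: (@coord_measurable_upd2 _ _ (fun=> E) in01).
- exact: coord_measurable_cst.
- exact: measurable_in.
- exact: in01P.
Qed.

Variable Tb : R.
Hypothesis Tb_gt0 : 0 < Tb.

Let dens_ge0 x : 0 <= Tb^-1 * expR (- (x / Tb)).
Proof. by rewrite mulr_ge0 ?expR_ge0// invr_ge0 ltW. Qed.

(** [q] is a function of the parameter so that the lemma serves twice: jointly in state and [p], and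
    for [p] alone at a fixed state. *)
Lemma measurable_bath_inner i d (T : measurableType d) (g : T -> st) (q : T -> R) :
  coord_measurable g -> measurable_fun [set: T] q -> (forall t, 0 < q t < 1) ->
  measurable_fun [set: T] (fun t => expo_int Tb (fun x => f (upd1 (g t) i (q t) x))).
Proof.
move=> cg mq q01; apply: (@measurable_param_integral _ _ _ _ 1) => //.
- by rewrite /= in_itv/=; lra.
- move=> t x; rewrite /= in_itv/= andbT => x0; rewrite mule_ge0 ?lee_fin//.
  by apply: nf.1; apply: upd1_pos => //; exact: cg.1.
- apply: emeasurable_funM.
    apply: (measurableT_comp (measurable_expo_density Tb)).
    by apply: (measurableT_comp (measurable_in 1 _)) => //; exact: measurable_itv.
  apply: nf.2.
  apply: (@coord_measurable_upd1 _ _ (g \o fst) (q \o fst) (inpos \o snd)).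
  + by apply: coord_measurable_comp.
  + by apply: measurableT_comp.
  + by move=> z; exact: q01.
  + by apply: measurableT_comp => //; exact: measurable_in.
  + by move=> z; exact: inposP.
Qed.

Lemma bath_inner_ge0 i E p : pos_state E -> 0 < p < 1 ->
  (0 <= expo_int Tb (fun x => f (upd1 E i p x)))%E.
Proof.
move=> E0 p01; apply: integral_ge0 => x; rewrite /= in_itv/= andbT => x0.
by rewrite mule_ge0 ?lee_fin//; apply: nf.1; exact: upd1_pos.
Qed.

Lemma measurable_bath i d (T : measurableType d) (g : T -> st) :
  coord_measurable g -> measurable_fun [set: T] (fun t => bath_op Tb i f (g t)).
Proof.
move=> cg; apply: (@measurable_param_integral _ _ _ _ (1/2)) => //.
- by rewrite /= in_itv/=; lra.
- by move=> t p; rewrite /= in_itv/= => p01; apply: bath_inner_ge0 => //; exact: cg.1.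
- apply: (@measurable_bath_inner _ _ _ (g \o fst) (in01 \o snd)).
  + by apply: coord_measurable_comp.
  + by apply: measurableT_comp => //; exact: measurable_in.
  + by move=> z; exact: in01P.
Qed.

Lemma measurable_bath_integrand i (E : st) : pos_state E ->
  measurable_fun (`]0, 1[%classic : set R)
    (fun p => expo_int Tb (fun x => f (upd1 E i p x))).
Proof.
move=> E0.
apply: (eq_measurable_fun (fun p => expo_int Tb (fun x => f (upd1 E i (in01 p) x)))).
  by move=> p p01; rewrite /in01 p01.
apply: measurable_funTS; apply: (@measurable_bath_inner _ _ _ (fun=> E) in01).
- exact: coord_measurable_cst.
- exact: measurable_in.
- exact: in01P.
Qed.

Lemma measurable_expo_integrand i (E : st) p : pos_state E -> 0 < p < 1 ->
  measurable_fun (`]0, +oo[%classic : set R)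
    (fun x => ((Tb^-1 * expR (- (x / Tb)))%:E * f (upd1 E i p x))%E).
Proof.
move=> E0 p01.
apply: emeasurable_funM; first exact: measurable_funTS (measurable_expo_density Tb).
apply: (eq_measurable_fun (fun x => f (upd1 E i p (inpos x)))).
  by move=> x x0; rewrite /inpos x0.
apply: measurable_funTS; apply: nf.2.
apply: (@coord_measurable_upd1 _ _ (fun=> E) (fun=> p) inpos) => //.
exact: measurable_in.
Qed.

End kernel.

(** * Weighted sums of the shape of the jump kernel *)

Section mixture.
Variables (R : realType) (n : nat) (l s rl rr : R) (r : nat -> R).
Hypotheses (l0 : 0 <= l) (s0 : 0 <= s) (rl0 : 0 <= rl) (rr0 : 0 <= rr).
Hypothesis r0 : forall k, 0 <= r k.
Implicit Types (a b : nat -> \bar R) (c d e g u v : \bar R).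
Local Open Scope ereal_scope.

(** The shape of [Jker] with the values of the exchange, bath and rest terms made arbitrary: [l]
    stands for the inverse uniformization constant and [s] for the probability of no move. *)
Definition mixture a c e u : \bar R :=
  l%:E * ((\sum_(0 <= k < n) (r k)%:E * a k) + rl%:E * c + rr%:E * e) + s%:E * u.

Let sum_ge0 a : (forall k, 0 <= a k) -> 0 <= \sum_(0 <= k < n) (r k)%:E * a k.
Proof. by move=> a0; apply: sume_ge0 => k _; rewrite mule_ge0 ?lee_fin. Qed.

Let rlM_ge0 c : 0 <= c -> 0 <= rl%:E * c. Proof. by move=> c0; rewrite mule_ge0. Qed.

Let rrM_ge0 c : 0 <= c -> 0 <= rr%:E * c. Proof. by move=> c0; rewrite mule_ge0. Qed.

Lemma mixture_ge0 a c e u : (forall k, 0 <= a k) -> 0 <= c -> 0 <= e -> 0 <= u ->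
  0 <= mixture a c e u.
Proof.
move=> a0 c0 e0 u0; apply: adde_ge0; last by rewrite mule_ge0 ?lee_fin.
rewrite mule_ge0 ?lee_fin//; apply: adde_ge0 (rrM_ge0 e0).
exact: adde_ge0 (sum_ge0 a0) (rlM_ge0 c0).
Qed.

Lemma mixture_le a b c d e g u v : (forall k, (k < n)%N -> a k <= b k) ->
  c <= d -> e <= g -> u <= v -> mixture a c e u <= mixture b d g v.
Proof.
move=> ab cd eg uv; apply: leeD; last exact: lee_wpmul2l.
apply: lee_wpmul2l => //; apply: leeD; last exact: lee_wpmul2l.
apply: leeD; last exact: lee_wpmul2l.
rewrite big_nat_cond [leRHS]big_nat_cond; apply: lee_sum => k /andP[/andP[_ kn] _].
by rewrite lee_wpmul2l ?lee_fin ?ab.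
Qed.

Lemma mixtureD a b c d e g u v : (forall k, 0 <= a k) -> (forall k, 0 <= b k) ->
  0 <= c -> 0 <= d -> 0 <= e -> 0 <= g -> 0 <= u -> 0 <= v ->
  mixture (fun k => a k + b k) (c + d) (e + g) (u + v) =
  mixture a c e u + mixture b d g v.
Proof.
move=> a0 b0 c0 d0 e0 g0 u0 v0; rewrite /mixture.
rewrite (eq_bigr (fun k => (r k)%:E * a k + (r k)%:E * b k)); last first.
  by move=> k _; exact: ge0_muleDr.
rewrite big_split /= (ge0_muleDr _ c0 d0) (ge0_muleDr _ e0 g0) (ge0_muleDr _ u0 v0).
rewrite (addeACA (\sum_(0 <= k < n) _)) [X in l%:E * X]addeACA ge0_muleDr.
- by rewrite addeACA.
- exact: adde_ge0 (adde_ge0 (sum_ge0 a0) (rlM_ge0 c0)) (rrM_ge0 e0).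
- exact: adde_ge0 (adde_ge0 (sum_ge0 b0) (rlM_ge0 d0)) (rrM_ge0 g0).
Qed.

Lemma mixtureZ (x : R) a c e u : (0 <= x)%R -> (forall k, 0 <= a k) ->
  0 <= c -> 0 <= e -> 0 <= u ->
  mixture (fun k => x%:E * a k) (x%:E * c) (x%:E * e) (x%:E * u) =
  x%:E * mixture a c e u.
Proof.
move=> x0 a0 c0 e0 u0; rewrite /mixture.
rewrite (eq_bigr (fun k => x%:E * ((r k)%:E * a k))); last by move=> k _; rewrite muleCA.
rewrite -ge0_sume_distrr; last by move=> k _; rewrite mule_ge0 ?lee_fin.
rewrite (muleCA rl%:E) (muleCA rr%:E) (muleCA s%:E).
rewrite -ge0_muleDr ?sum_ge0 ?rlM_ge0// -ge0_muleDr ?rrM_ge0//; last first.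
  exact: adde_ge0 (sum_ge0 a0) (rlM_ge0 c0).
rewrite (muleCA l%:E) -ge0_muleDr ?mule_ge0 ?lee_fin//.
exact: adde_ge0 (adde_ge0 (sum_ge0 a0) (rlM_ge0 c0)) (rrM_ge0 e0).
Qed.

Lemma mixture_cst (x : R) :
  (l * (\sum_(0 <= k < n) r k + rl + rr) + s = 1)%R ->
  mixture (fun=> x%:E) x%:E x%:E x%:E = x%:E.
Proof.
move=> ls1; rewrite /mixture.
have -> : \sum_(0 <= k < n) (r k)%:E * x%:E = (\sum_(0 <= k < n) r k * x)%R%:E.
  by rewrite -sumEFin.
transitivity ((l * (\sum_(0 <= k < n) r k * x + rl * x + rr * x) + s * x)%R%:E) => //.
by rewrite -mulr_suml -!mulrDl mulrA -mulrDl ls1 mul1r.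
Qed.

End mixture.

(** * Linearity, monotonicity and measurability of the jump kernel *)

Section operators.
Variables (R : realType) (N : nat).
Notation st := (state R N).
Implicit Types (E : st) (f g : st -> \bar R).

Lemma measurable_on_posD f g : measurable_on_pos f -> measurable_on_pos g ->
  measurable_on_pos (fun E => f E + g E)%E.
Proof.
move=> [f0 mf] [g0 mg]; split=> [E E0|d T u cu]; first by rewrite adde_ge0 ?f0 ?g0.
by apply: emeasurable_funD; [exact: mf|exact: mg].
Qed.

Lemma measurable_on_posZ (a : R) f : 0 <= a -> measurable_on_pos f ->
  measurable_on_pos (fun E => a%:E * f E)%E.
Proof.
move=> a0 [f0 mf]; split=> [E E0|d T u cu]; first by rewrite mule_ge0 ?f0.
by apply: measurable_funeM; exact: mf.
Qed.

Lemma measurable_on_pos_cst (c : R) : 0 <= c -> measurable_on_pos (fun _ : st => c%:E).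
Proof. by move=> c0; split=> // d T u cu; exact: measurable_cst. Qed.

Lemma measurable_on_pos_V eta : measurable_on_pos (fun E : st => (Vf eta E)%:E).
Proof.
split=> [E E0|d T u cu]; first by rewrite lee_fin Vf_ge0.
apply/measurable_EFinP; apply: measurable_sum => m; apply: measurable_sum => k.
apply: (measurableT_comp (measurable_powR _)).
by apply: measurable_sum => j; exact: measurable_Eat.
Qed.

Lemma measurable_on_pos_W : measurable_on_pos (fun E : st => (Wf E)%:E).
Proof.
split=> [E E0|d T u cu]; first by rewrite lee_fin Wf_ge0.
by apply/measurable_EFinP; apply: measurable_sum => k; exact: cu.2.
Qed.

Lemma measurable_on_pos_if eta (M : R) f g : measurable_on_pos f -> measurable_on_pos g ->
  measurable_on_pos (fun E => if (Vf eta E <= M)%R then f E else g E).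
Proof.
move=> [f0 mf] [g0 mg]; split=> [E E0|d T u cu]; first by case: ifP => _; [exact: f0|exact: g0].
apply: measurable_fun_ifT; [|exact: mf|exact: mg].
apply: measurable_fun_ler => //; apply/measurable_EFinP.
exact: (measurable_on_pos_V eta).2 _ _ _ cu.
Qed.


Section exchange.
Variables (i : nat).

Lemma exchange_ge0 f E : (forall y : st, pos_state y -> 0 <= f y)%E -> pos_state E ->
  (0 <= exchange_op i f E)%E.
Proof.
move=> f0 E0; apply: integral_ge0 => p; rewrite /= in_itv/= => p01.
by apply: f0; exact: upd2_pos.
Qed.

Lemma exchange_le f g E : (forall y : st, pos_state y -> 0 <= f y)%E ->
  (forall y, pos_state y -> f y <= g y)%E -> pos_state E ->
  (exchange_op i f E <= exchange_op i g E)%E.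
Proof.
move=> f0 fg E0; apply: ge0_le_integral_nonmeas => p; rewrite /= in_itv/= => p01.
  by apply: f0; exact: upd2_pos.
by apply: fg; exact: upd2_pos.
Qed.

Lemma exchangeD f g E : measurable_on_pos f -> measurable_on_pos g -> pos_state E ->
  exchange_op i (fun y => f y + g y)%E E = (exchange_op i f E + exchange_op i g E)%E.
Proof.
move=> nf ng E0; apply: ge0_integralD => //.
- by move=> p; rewrite /= in_itv/= => p01; apply: nf.1; exact: upd2_pos.
- exact: measurable_exchange_integrand.
- by move=> p; rewrite /= in_itv/= => p01; apply: ng.1; exact: upd2_pos.
- exact: measurable_exchange_integrand.
Qed.

Lemma exchangeZ (a : R) f E : 0 <= a -> measurable_on_pos f -> pos_state E ->
  exchange_op i (fun y => a%:E * f y)%E E = (a%:E * exchange_op i f E)%E.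
Proof.
move=> a0 nf E0; apply: ge0_integralZl_EFin => //.
- by move=> p; rewrite /= in_itv/= => p01; apply: nf.1; exact: upd2_pos.
- exact: measurable_exchange_integrand.
Qed.

End exchange.

Section bath.
Variables (i : nat) (Tb : R).
Hypothesis Tb0 : 0 < Tb.

Let dens_ge0 x : (0 <= (Tb^-1 * expR (- (x / Tb)))%:E)%E.
Proof. by rewrite lee_fin mulr_ge0 ?expR_ge0// invr_ge0 ltW. Qed.

Lemma bath_ge0 f E : (forall y : st, pos_state y -> 0 <= f y)%E -> pos_state E ->
  (0 <= bath_op Tb i f E)%E.
Proof.
move=> f0 E0; apply: integral_ge0 => p; rewrite /= in_itv/= => p01.
apply: integral_ge0 => x; rewrite /= in_itv/= andbT => x0.
by rewrite mule_ge0//; apply: f0; exact: upd1_pos.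
Qed.

Lemma bath_le f g E : (forall y : st, pos_state y -> 0 <= f y)%E ->
  (forall y, pos_state y -> f y <= g y)%E -> pos_state E ->
  (bath_op Tb i f E <= bath_op Tb i g E)%E.
Proof.
move=> f0 fg E0; apply: ge0_le_integral_nonmeas => p; rewrite /= in_itv/= => p01.
  apply: integral_ge0 => x; rewrite /= in_itv/= andbT => x0.
  by rewrite mule_ge0//; apply: f0; exact: upd1_pos.
apply: ge0_le_integral_nonmeas => x; rewrite /= in_itv/= andbT => x0.
  by rewrite mule_ge0//; apply: f0; exact: upd1_pos.
by rewrite lee_wpmul2l//; apply: fg; exact: upd1_pos.
Qed.

Lemma bathD f g E : measurable_on_pos f -> measurable_on_pos g -> pos_state E ->
  bath_op Tb i (fun y => f y + g y)%E E = (bath_op Tb i f E + bath_op Tb i g E)%E.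
Proof.
move=> nf ng E0; rewrite /bath_op /unif_int -ge0_integralD//; last 4 first.
- by move=> p; rewrite /= in_itv/= => p01; exact: bath_inner_ge0.
- exact: measurable_bath_integrand.
- by move=> p; rewrite /= in_itv/= => p01; exact: bath_inner_ge0.
- exact: measurable_bath_integrand.
apply: eq_integral => p; rewrite inE/= in_itv/= => p01.
rewrite /expo_int -ge0_integralD//; last 4 first.
- move=> x; rewrite /= in_itv/= andbT => x0; rewrite mule_ge0//.
  by apply: nf.1; exact: upd1_pos.
- exact: measurable_expo_integrand.
- move=> x; rewrite /= in_itv/= andbT => x0; rewrite mule_ge0//.
  by apply: ng.1; exact: upd1_pos.
- exact: measurable_expo_integrand.
apply: eq_integral => x; rewrite inE/= in_itv/= andbT => x0.
by rewrite muleDr// ge0_adde_def// inE; [apply: nf.1|apply: ng.1]; exact: upd1_pos.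
Qed.

Lemma bathZ (a : R) f E : 0 <= a -> measurable_on_pos f -> pos_state E ->
  bath_op Tb i (fun y => a%:E * f y)%E E = (a%:E * bath_op Tb i f E)%E.
Proof.
move=> a0 nf E0; rewrite /bath_op /unif_int -ge0_integralZl_EFin//; last 2 first.
- by move=> p; rewrite /= in_itv/= => p01; exact: bath_inner_ge0.
- exact: measurable_bath_integrand.
apply: eq_integral => p; rewrite inE/= in_itv/= => p01.
rewrite /expo_int -ge0_integralZl_EFin//; last 2 first.
- move=> x; rewrite /= in_itv/= andbT => x0; rewrite mule_ge0//.
  by apply: nf.1; exact: upd1_pos.
- exact: measurable_expo_integrand.
by apply: eq_integral => x _; rewrite muleCA.
Qed.

End bath.

Variables (K TL TR : R).
Hypotheses (hN : (1 <= N)%N) (K0 : 0 < K) (TL0 : 0 < TL) (TR0 : 0 < TR).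
Notation J := (@Jker R N K TL TR).

Let rate_ge0 a b : 0 <= rate K a b.
Proof. by rewrite /rate le_min sqrtr_ge0 ltW. Qed.

Let rate_le a b : rate K a b <= K.
Proof. by rewrite /rate ge_min lexx. Qed.

Let Lam0 : 0 < Lam N K.
Proof. by rewrite mulr_gt0. Qed.

Let stay E := 1 - total_rate K TL TR E / Lam N K.

Let stay_ge0 E : 0 <= stay E.
Proof.
rewrite /stay subr_ge0 ler_pdivrMr// mul1r /total_rate /Lam.
(* The [N + 1] clocks are [N - 1] exchanges and two baths, which uses [1 <= N]; each rate is at most
   [K]. *)
have -> : N.+1%:R * K = (\sum_(0 <= k < N.-1) K) + K + K.
  rewrite sumr_const_nat subn0 -mulr_natl.
  by case: N hN => // n _ /=; rewrite -(addn1 n.+1) -(addn1 n) !natrD; ring.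
by rewrite !lerD//; apply: ler_sum.
Qed.

Let mix E := @mixture R N.-1 (Lam N K)^-1 (stay E) (rate K TL (Eat E 0))
  (rate K (Eat E N.-1) TR) (fun k => rate K (Eat E k) (Eat E k.+1)).

Let JE f E : J f E = mix E (fun k => exchange_op k f E) (bath_op TL 0 f E)
  (bath_op TR N.-1 f E) (f E).
Proof. by []. Qed.

Let l0 : 0 <= (Lam N K)^-1. Proof. by rewrite invr_ge0 ltW. Qed.

Lemma Jker_ge0 f : (forall y, pos_state y -> 0 <= f y)%E ->
  forall E, pos_state E -> (0 <= J f E)%E.
Proof.
move=> f0 E E0; rewrite JE; apply: mixture_ge0 => //.
- by move=> k; exact: exchange_ge0.
- exact: bath_ge0.
- exact: bath_ge0.
- exact: f0.
Qed.

Lemma Jker_le f g : (forall y, pos_state y -> 0 <= f y)%E ->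
  (forall y, pos_state y -> f y <= g y)%E ->
  forall E, pos_state E -> (J f E <= J g E)%E.
Proof.
move=> f0 fg E E0; rewrite !JE; apply: mixture_le => //.
- by move=> k _; exact: exchange_le.
- exact: bath_le.
- exact: bath_le.
- exact: fg.
Qed.

Lemma JkerD f g E : measurable_on_pos f -> measurable_on_pos g -> pos_state E ->
  J (fun y => f y + g y)%E E = (J f E + J g E)%E.
Proof.
move=> nf ng E0; have [f0 _] := nf; have [g0 _] := ng.
rewrite !JE /mix -mixtureD//; first last.
- exact: g0.
- exact: f0.
- exact: bath_ge0.
- exact: bath_ge0.
- exact: bath_ge0.
- exact: bath_ge0.
- by move=> k; exact: exchange_ge0.
- by move=> k; exact: exchange_ge0.
rewrite !bathD//; congr mixture.
by apply/funext => k; exact: exchangeD.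
Qed.

Lemma JkerZ (a : R) f E : 0 <= a -> measurable_on_pos f -> pos_state E ->
  J (fun y => a%:E * f y)%E E = (a%:E * J f E)%E.
Proof.
move=> a0 nf E0; have [f0 _] := nf.
rewrite !JE /mix -mixtureZ//; first last.
- exact: f0.
- exact: bath_ge0.
- exact: bath_ge0.
- by move=> k; exact: exchange_ge0.
rewrite !bathZ//; congr mixture.
by apply/funext => k; exact: exchangeZ.
Qed.

(** The weights of [Jker] sum to 1, so a common bound on all its terms passes to the average. *)
Lemma Jker_bound f E (c : R) :
  (forall k, (k < N.-1)%N -> exchange_op k f E <= c%:E)%E ->
  (bath_op TL 0 f E <= c%:E)%E -> (bath_op TR N.-1 f E <= c%:E)%E ->
  (f E <= c%:E)%E -> (J f E <= c%:E)%E.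
Proof.
move=> h1 h2 h3 h4; rewrite JE -[leRHS](@mixture_cst R N.-1 (Lam N K)^-1 (stay E)
  (rate K TL (Eat E 0)) (rate K (Eat E N.-1) TR)
  (fun k => rate K (Eat E k) (Eat E k.+1)) c).
  exact: mixture_le.
by rewrite /stay /total_rate; field; rewrite gt_eqF.
Qed.

Lemma measurable_on_pos_J f : measurable_on_pos f -> measurable_on_pos (J f).
Proof.
move=> nf; split=> [E E0|d T u cu]; first by apply: Jker_ge0 => //; exact: nf.1.
have mE k := measurable_Eat k cu.
have msqrt : measurable_fun [set: R] (@Num.sqrt R).
  by apply: continuous_measurable_fun; exact: sqrt_continuous.
have mrate (a b : T -> R) : measurable_fun [set: T] a -> measurable_fun [set: T] b ->
    measurable_fun [set: T] (fun t => rate K (a t) (b t)).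
  move=> ma mb; apply: measurable_minr => //.
  by apply: measurableT_comp => //; exact: measurable_minr.
have mrk k : measurable_fun [set: T] (fun t => rate K (Eat (u t) k) (Eat (u t) k.+1)).
  exact: mrate.
have mr0 : measurable_fun [set: T] (fun t => rate K TL (Eat (u t) 0)) by exact: mrate.
have mrN : measurable_fun [set: T] (fun t => rate K (Eat (u t) N.-1) TR) by exact: mrate.
rewrite /Jker; apply: emeasurable_funD; last first.
  apply: emeasurable_funM; last exact: nf.2.
  apply/measurable_EFinP; apply: measurable_funB => //; apply: measurable_funM => //.
  apply: measurable_funD => //; apply: measurable_funD => //.
  exact: measurable_sum.
apply: measurable_funeM; apply: emeasurable_funD.
  apply: emeasurable_funD.
    apply: emeasurable_sum => k; apply: emeasurable_funM; first exact/measurable_EFinP.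
    exact: measurable_exchange.
  by apply: emeasurable_funM; [exact/measurable_EFinP|exact: measurable_bath].
by apply: emeasurable_funM; [exact/measurable_EFinP|exact: measurable_bath].
Qed.

End operators.

(** * Poisson averages *)

Lemma nneseries_expR (R : realType) (y : R) : 0 <= y ->
  (\sum_(0 <= k <oo) (y ^+ k / k`!%:R)%:E)%E = (expR y)%:E.
Proof.
move=> y0; rewrite /expR -EFin_lim; last exact: is_cvg_series_exp_coeff.
congr (limn _); apply/funext => n /=.
by rewrite /series /= -sumEFin.
Qed.

Section poisson.
Variables (R : realType) (x : R).
Hypothesis x0 : 0 <= x.

Definition poisson_weight (k : nat) : R := expR (- x) * x ^+ k / k`!%:R.

Lemma poisson_weight_ge0 k : 0 <= poisson_weight k.
Proof. by rewrite /poisson_weight divr_ge0// mulr_ge0 ?expR_ge0// exprn_ge0. Qed.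

(** The Poisson mean of [c^k] is [exp((c-1) x)]. The form [a + b c^k] covers the three uses: total
    mass, growth of [W] and growth of [V]. *)
Lemma poisson_mean_le (u : nat -> \bar R) (a b c : R) :
  0 <= a -> 0 <= b -> 0 <= c -> (forall k, 0 <= u k)%E ->
  (forall k, u k <= (a + b * c ^+ k)%:E)%E ->
  (\sum_(0 <= k <oo) (poisson_weight k)%:E * u k <= (a + b * expR ((c - 1) * x))%:E)%E.
Proof.
move=> a0 b0 c0 u0 uk.
pose va k := (x ^+ k / k`!%:R)%:E.
pose vb k := ((c * x) ^+ k / k`!%:R)%:E.
have va0 k : (0 <= va k)%E by rewrite lee_fin divr_ge0// exprn_ge0.
have vb0 k : (0 <= vb k)%E by rewrite lee_fin divr_ge0// exprn_ge0// mulr_ge0.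
have ea0 : 0 <= expR (- x) * a by rewrite mulr_ge0// expR_ge0.
have eb0 : 0 <= expR (- x) * b by rewrite mulr_ge0// expR_ge0.
apply: (@le_trans _ _ (\sum_(0 <= k <oo)
    ((expR (- x) * a)%:E * va k + (expR (- x) * b)%:E * vb k))%E).
  apply: lee_nneseries => k _; first by rewrite mule_ge0// lee_fin poisson_weight_ge0.
  apply: (le_trans (lee_wpmul2l _ (uk k))); first by rewrite lee_fin poisson_weight_ge0.
  rewrite /va /vb -!EFinM -EFinD lee_fin le_eqVlt; apply/orP; left; apply/eqP.
  by rewrite /poisson_weight exprMn; ring.
rewrite nneseriesD; [|by move=> k _ _; rewrite mule_ge0..].
rewrite nneseriesZl// nneseriesZl// nneseries_expR// nneseries_expR ?mulr_ge0//.
rewrite -!EFinM -EFinD lee_fin le_eqVlt; apply/orP; left; apply/eqP.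
rewrite mulrBl mul1r expRD -!mulrA mulrCA [in RHS]mulrCA.
by rewrite [X in a * X](_ : _ = 1) ?mulr1 ?[expR (- x) * expR x]mulrC ?expRxMexpNx_1//; ring.
Qed.

End poisson.

(** * Bounds for the semigroup *)

Section semigroup.
Variables (R : realType) (N : nat) (K TL TR t : R).
Hypotheses (hN : (1 <= N)%N) (K0 : 0 < K) (TL0 : 0 < TL) (TR0 : 0 < TR) (t0 : 0 < t).
Notation st := (state R N).
Notation J := (@Jker R N K TL TR).
Notation P := (@Pt R N K TL TR t).
Implicit Types (f g : st -> \bar R) (E : st).

Let x := Lam N K * t.

Let x0 : 0 <= x.
Proof. by rewrite /x /Lam !mulr_ge0// ltW. Qed.

Let PE f E : P f E = (\sum_(0 <= k <oo) (poisson_weight x k)%:E * iter k J f E)%E.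
Proof. by []. Qed.

Let w0 k : (0 <= (poisson_weight x k)%:E)%E.
Proof. by rewrite lee_fin poisson_weight_ge0. Qed.

Lemma iter_Jker_ge0 k f : (forall y, pos_state y -> 0 <= f y)%E ->
  forall E, pos_state E -> (0 <= iter k J f E)%E.
Proof. by move=> f0; elim: k => //= k IH; exact: Jker_ge0. Qed.

Lemma iter_Jker_le k f g : (forall y, pos_state y -> 0 <= f y)%E ->
  (forall y, pos_state y -> f y <= g y)%E ->
  forall E, pos_state E -> (iter k J f E <= iter k J g E)%E.
Proof.
move=> f0 fg; elim: k => //= k IH; apply: Jker_le => //.
exact: iter_Jker_ge0.
Qed.

(** The iterates are only known to agree at positive states, so equality is obtained from
    monotonicity in both directions. *)
Let eq_Jker f g E : (forall y, pos_state y -> 0 <= f y)%E ->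
  (forall y, pos_state y -> f y = g y) -> pos_state E -> J f E = J g E.
Proof.
move=> f0 fg E0; apply/eqP; rewrite eq_le; apply/andP; split; apply: Jker_le => // y y0.
- by rewrite fg.
- by rewrite -fg// f0.
- by rewrite fg.
Qed.

Lemma measurable_on_pos_iter k f : measurable_on_pos f -> measurable_on_pos (iter k J f).
Proof. by move=> nf; elim: k => //= k IH; exact: measurable_on_pos_J. Qed.

Lemma iter_JkerD k f g E : measurable_on_pos f -> measurable_on_pos g -> pos_state E ->
  iter k J (fun y => f y + g y)%E E = (iter k J f E + iter k J g E)%E.
Proof.
move=> nf ng; elim: k E => //= k IH E E0.
rewrite -JkerD//; [|exact: measurable_on_pos_iter..].
apply: eq_Jker => //; apply: iter_Jker_ge0.
exact: (measurable_on_posD nf ng).1.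
Qed.

Lemma iter_JkerZ k (a : R) f E : 0 <= a -> measurable_on_pos f -> pos_state E ->
  iter k J (fun y => a%:E * f y)%E E = (a%:E * iter k J f E)%E.
Proof.
move=> a0 nf; elim: k E => //= k IH E E0.
rewrite -JkerZ//; last exact: measurable_on_pos_iter.
apply: eq_Jker => //; apply: iter_Jker_ge0.
exact: (measurable_on_posZ a0 nf).1.
Qed.

Let bath_bound (Tb : R) i f E (c : R) : 0 < Tb -> measurable_on_pos f -> pos_state E ->
  (forall p, (0 < p < 1)%R -> expo_int Tb (fun y => f (upd1 E i p y)) <= c%:E)%E ->
  (bath_op Tb i f E <= c%:E)%E.
Proof.
move=> Tb0 nf E0 h; rewrite -[leRHS]unif_int_cst; apply: ge0_le_integral_nonmeas => p.
  by rewrite /= in_itv/= => p01; exact: bath_inner_ge0.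
by rewrite /= in_itv/= => p01; exact: h.
Qed.

Let expo_int_le (Tb : R) (u v : R -> \bar R) : 0 < Tb ->
  (forall y, (0 < y)%R -> 0 <= u y)%E -> (forall y, (0 < y)%R -> u y <= v y)%E ->
  (expo_int Tb u <= expo_int Tb v)%E.
Proof.
move=> Tb0 u0 uv.
have d0 y : (0 <= (Tb^-1 * expR (- (y / Tb)))%:E)%E.
  by rewrite lee_fin mulr_ge0 ?expR_ge0// invr_ge0 ltW.
apply: ge0_le_integral_nonmeas => y; rewrite /= in_itv/= andbT => y0.
  by rewrite mule_ge0// u0.
by rewrite lee_wpmul2l// uv.
Qed.

Let expo_int_cst_le (Tb c : R) : 0 < Tb -> 0 <= c -> (expo_int Tb (fun=> c%:E) <= c%:E)%E.
Proof.
move=> Tb0 c0; rewrite -[leRHS]mule1.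
apply: le_trans (lee_wpmul2l _ (expo_int1_le Tb0)); last by rewrite lee_fin.
rewrite /expo_int -ge0_integralZl_EFin//; last 2 first.
- move=> y _; rewrite mule1 lee_fin mulr_ge0 ?expR_ge0// invr_ge0; exact: ltW.
- by apply: emeasurable_funM => //; exact: measurable_funTS (measurable_expo_density Tb).
rewrite le_eqVlt; apply/orP; left; apply/eqP; apply: eq_integral => y _.
by rewrite mule1 muleC.
Qed.

Lemma iter_Jker1_le k E : pos_state E -> (iter k J (fun=> 1%E) E <= 1)%E.
Proof.
elim: k E => //= k IH E E0.
apply: (le_trans (@Jker_le _ _ _ _ _ hN K0 TL0 TR0 _ (fun=> 1%E) _ IH E E0)).
  by move=> y y0; apply: iter_Jker_ge0.
have n1 := measurable_on_pos_cst N (@ler01 R).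
apply: Jker_bound => //.
- by move=> i _; rewrite /exchange_op unif_int_cst.
- by apply: bath_bound => // p _; exact: expo_int1_le.
- by apply: bath_bound => // p _; exact: expo_int1_le.
Qed.

(** Exchanges conserve [W], and a bath adds at most its exponential energy, whose mean is bounded by
    [4 Tb]. *)
Lemma Jker_W_le (c : R) E : 0 <= c -> pos_state E ->
  (J (fun y => (Wf y + c)%:E) E <= (Wf E + c + (4 * TL + 4 * TR))%:E)%E.
Proof.
move=> c0 E0.
have nW : measurable_on_pos (fun y : st => (Wf y + c)%:E).
  exact: measurable_on_posD (measurable_on_pos_W R N) (measurable_on_pos_cst N c0).
have W0 := Wf_ge0 E0; have TLp := TL0; have TRp := TR0.
have b0 : 0 <= Wf E + c by exact: addr_ge0.
have bathW Tb i : 0 < Tb -> Tb <= TL + TR -> (i < N)%N ->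
    (bath_op Tb i (fun y : st => (Wf y + c)%:E) E <= (Wf E + c + (4 * TL + 4 * TR))%:E)%E.
  move=> Tb0 TbT iN; apply: bath_bound => // p p01.
  apply: (@le_trans _ _ (expo_int Tb (fun y => (y + (Wf E + c))%:E))).
    apply: expo_int_le => // y y0.
      by apply: nW.1; exact: upd1_pos.
    by rewrite lee_fin; have := Wf_upd1_le E0 p01 y0 iN; lra.
  apply: (le_trans (expo_int_affine_le Tb0 b0)).
  by rewrite lee_fin; lra.
apply: Jker_bound => //.
- move=> k kN; rewrite (_ : exchange_op _ _ _ = unif_int (fun=> (Wf E + c)%:E)).
    by rewrite unif_int_cst lee_fin; lra.
  by congr unif_int; apply/funext => p; rewrite Wf_upd2.
- by apply: bathW => //; lra.
- by apply: bathW => //; [lra|lia].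
- by rewrite lee_fin; lra.
Qed.

Lemma iter_Jker_W_le k E : pos_state E ->
  (iter k J (fun y => (Wf y)%:E) E <= (Wf E + (4 * TL + 4 * TR) * 2 ^+ k)%:E)%E.
Proof.
move=> E0; have TLp := TL0; have TRp := TR0; pose b := 4 * TL + 4 * TR.
have b0 : 0 <= b by rewrite /b; lra.
have W0 y : pos_state y -> (0 <= (Wf (y : st))%:E)%E by move=> y0; rewrite lee_fin Wf_ge0.
have h : (iter k J (fun y => (Wf y)%:E) E <= (Wf E + k%:R * b)%:E)%E.
  elim: k E E0 => [|k IH] E E0 /=; first by rewrite mul0r addr0.
  apply: (le_trans (@Jker_le _ _ _ _ _ hN K0 TL0 TR0 _ (fun y => (Wf y + k%:R * b)%:E) _ IH E E0)).
    by move=> y y0; apply: iter_Jker_ge0.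
  have kb0 : 0 <= k%:R * b by exact: mulr_ge0.
  apply: (le_trans (Jker_W_le kb0 E0)); rewrite lee_fin -/b -(addn1 k) natrD; lra.
(* The linear growth in [k] is weakened to [2^k] to fit the form [a + b c^k]. *)
apply: (le_trans h); rewrite lee_fin lerD2l mulrC ler_wpM2l//.
by rewrite -natrX ler_nat ltnW// ltn_expl.
Qed.

Lemma op_W_le E : pos_state E ->
  (P (fun y => (Wf y)%:E) E <= (Wf E + (4 * TL + 4 * TR) * expR x)%:E)%E.
Proof.
move=> E0; have b0 : 0 <= 4 * TL + 4 * TR by have := TL0; have := TR0; lra.
have -> : x = (2 - 1) * x by ring.
rewrite PE; apply: poisson_mean_le => //; first exact: Wf_ge0.
- by move=> k; apply: iter_Jker_ge0 => // y y0; rewrite lee_fin Wf_ge0.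
- by move=> k; exact: iter_Jker_W_le.
Qed.

Variable eta : R.
Hypothesis eta01 : 0 < eta < 1.

Let unif_endpoints_le (v : R) : 0 <= v ->
  (unif_int (fun p => ((p `^ (eta / 2 - 1) + (1 - p) `^ (eta / 2 - 1)) * v)%:E)
    <= (4 / eta * v)%:E)%E.
Proof.
have /andP[eta0 eta1] := eta01.
have g1 : -1 < eta / 2 - 1 by lra.
set g := eta / 2 - 1 in g1 *.
move=> v0.
have m1 : measurable_fun (`]0, 1[%classic : set R) (fun p : R => (p `^ g)%:E).
  by apply: measurable_funTS; apply/measurable_EFinP; exact: measurable_powR.
have m2 : measurable_fun (`]0, 1[%classic : set R) (fun p : R => ((1 - p) `^ g)%:E).
  apply: measurable_funTS; apply/measurable_EFinP.
  by apply: (measurableT_comp (measurable_powR _)); exact: measurable_funB.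
rewrite /unif_int.
under eq_integral do rewrite mulrC EFinM EFinD.
rewrite ge0_integralZl_EFin//; last 2 first.
- by move=> p _; rewrite adde_ge0 ?lee_fin ?powR_ge0.
- exact: emeasurable_funD.
rewrite ge0_integralD//; [|by move=> p _; rewrite lee_fin powR_ge0..].
(* Each endpoint contributes [1/(eta/2)], which gives [4/eta] in total. *)
apply: (le_trans (lee_wpmul2l _ (leeD (unif_int_powR_le g1) (unif_int_onem_powR_le g1)))).
  by rewrite lee_fin.
rewrite -EFinD -EFinM lee_fin le_eqVlt; apply/orP; left; apply/eqP.
by rewrite /g; field; rewrite gt_eqF.
Qed.

Lemma Jker_V_le (c : R) E : 0 <= c -> pos_state E ->
  (J (fun y => (c * Vf eta y)%:E) E <= (4 / eta * (c * Vf eta E))%:E)%E.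
Proof.
move=> c0 E0; have /andP[eta0 eta1] := eta01.
have cV0 (y : st) : 0 <= c * Vf eta y by rewrite mulr_ge0// Vf_ge0.
have nV : measurable_on_pos (fun y : st => (c * Vf eta y)%:E).
  exact: measurable_on_posZ c0 (@measurable_on_pos_V R N eta).
have endpts := unif_endpoints_le (cV0 E).
have bathV Tb i : 0 < Tb ->
    (bath_op Tb i (fun y : st => (c * Vf eta y)%:E) E <= (4 / eta * (c * Vf eta E))%:E)%E.
  move=> Tb0; apply: le_trans endpts; apply: ge0_le_integral_nonmeas => p.
    by rewrite /= in_itv/= => p01; exact: (bath_inner_ge0 nV).
  rewrite /= in_itv/= => p01.
  apply: (@le_trans _ _ (expo_int Tb (fun=> ((p `^ (eta / 2 - 1)) * (c * Vf eta E))%:E))).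
    apply: expo_int_le => // y y0; rewrite lee_fin//.
    by rewrite mulrCA ler_wpM2l// Vf_upd1_le.
  apply: (le_trans (expo_int_cst_le Tb0 _)); first by rewrite mulr_ge0// powR_ge0.
  by rewrite lee_fin ler_wpM2r// lerDl powR_ge0.
apply: Jker_bound => //.
- move=> k kN; apply: le_trans endpts; apply: ge0_le_integral_nonmeas => p.
    by rewrite lee_fin.
  rewrite /= in_itv/= => p01; rewrite lee_fin mulrCA ler_wpM2l//.
  exact: Vf_upd2_le.
- exact: bathV.
- exact: bathV.
- rewrite lee_fin ler_peMl// ler_pdivlMr//; lra.
Qed.

(** One jump multiplies the mean of [V] by at most [4/eta]; averaging the powers over the Poisson
    number of jumps gives the exponential. *)
Lemma op_V_le E : pos_state E ->
  (P (fun y => (Vf eta y)%:E) E <= (expR ((4 / eta - 1) * x) * Vf eta E)%:E)%E.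
Proof.
move=> E0; have /andP[eta0 eta1] := eta01.
have V0 (y : st) : 0 <= Vf eta y by exact: Vf_ge0.
have c0 : 0 <= 4 / eta by rewrite divr_ge0// ltW.
rewrite PE mulrC -[X in (X%:E)]add0r; apply: poisson_mean_le => //.
  by move=> k; apply: iter_Jker_ge0 => // y _; rewrite lee_fin.
move=> k; rewrite add0r mulrC.
elim: k E E0 => [|k IH] E E0 /=; first by rewrite expr0 mul1r.
apply: (le_trans (@Jker_le _ _ _ _ _ hN K0 TL0 TR0 _
  (fun y => ((4 / eta) ^+ k * Vf eta y)%:E) _ IH E E0)).
  by move=> y y0; apply: iter_Jker_ge0 => // z _; rewrite lee_fin.
by rewrite exprS -mulrA; apply: Jker_V_le => //; exact: exprn_ge0.
Qed.

(** Every property passes from the iterates of the jump kernel to their Poisson series, whose terms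
    are nonnegative at positive states. *)
Lemma submarkov_Pt : submarkov (@pos_state R N) (@measurable_on_pos R N) P.
Proof.
split.
- by move=> f y [f0 _]; exact: f0.
- exact: measurable_on_pos_cst.
- exact: measurable_on_posD.
- exact: measurable_on_posZ.
- move=> f nf; have iterf k := measurable_on_pos_iter k nf; split=> [E E0|d T u cu].
    rewrite PE; apply: nneseries_ge0 => k _ _; rewrite mule_ge0//.
    exact: (iterf k).1.
  apply: (@ge0_emeasurable_sum _ _ _ _
    (fun k t => (poisson_weight x k)%:E * iter k J f (u t))%E predT) => //.
    by move=> k z _ _; rewrite mule_ge0//; apply: (iterf k).1; exact: cu.1.
  by move=> k _; apply: measurable_funeM; exact: (iterf k).2.
- move=> f f0 E E0; rewrite PE; apply: nneseries_ge0 => k _ _; rewrite mule_ge0//.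
  exact: iter_Jker_ge0.
- move=> f g f0 fg E E0; rewrite !PE; apply: lee_nneseries => k _.
    by move=> _; rewrite mule_ge0//; exact: iter_Jker_ge0.
  by rewrite lee_wpmul2l//; exact: iter_Jker_le.
- move=> f g nf ng E E0; rewrite !PE -nneseriesD; first last.
  + by move=> k _ _; rewrite mule_ge0//; apply: iter_Jker_ge0 => //; exact: ng.1.
  + by move=> k _ _; rewrite mule_ge0//; apply: iter_Jker_ge0 => //; exact: nf.1.
  apply: eq_eseriesr => k _; rewrite iter_JkerD// ge0_muleDr//.
  + by apply: iter_Jker_ge0 => //; exact: nf.1.
  + by apply: iter_Jker_ge0 => //; exact: ng.1.
- move=> a f a0 nf E E0; rewrite !PE -nneseriesZl; last first.
    by move=> k _; rewrite mule_ge0//; apply: iter_Jker_ge0 => //; exact: nf.1.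
  by apply: eq_eseriesr => k _; rewrite iter_JkerZ// muleCA.
- move=> E E0; rewrite PE.
  have := @poisson_mean_le R x x0 (fun k => iter k J (fun=> 1%E) E) 1 0 0 ler01 (lexx 0) (lexx 0).
  rewrite mul0r addr0; apply.
    by move=> k; apply: iter_Jker_ge0.
  by move=> k; rewrite mul0r addr0; exact: iter_Jker1_le.
Qed.

End semigroup.

Theorem theorem6p6 (R : realType) (N : nat) (hN : (1 <= N)%N) (TL TR : R)
  (hTL : 0 < TL) (hTR : 0 < TR) :
  exists K0 : R, forall K : R, K0 <= K ->
  exists eta0 : R, 0 < eta0 /\ forall eta : R, 0 < eta < eta0 ->
  exists h0 : R, 0 < h0 /\ forall h : R, 0 < h < h0 ->
  let alpha := 1 - (2 * (1 - eta))^-1 in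
  let hat_alpha := 2 - 2 * eta in
  forall M0 : R, 1 < M0 ->
  (exists c0 : R, 0 < c0 /\
     forall E : state R N, pos_state E -> M0 < Vf eta E ->
       (Pt K TL TR h (fun y => (Vf eta y)%:E) E
          <= (Vf eta E - c0 * powR (Vf eta E) alpha)%:E)%E) ->
  forall M1 : R, 1 < M1 ->
  (exists delta : R, 0 < delta /\
     forall E : state R N, pos_state E -> Vf eta E <= M0 -> M1 < Wf E ->
       (hatPW K TL TR h eta M0 E <= ((1 - delta) * Wf E)%:E)%E) ->
  forall eps : R, 0 < eps ->
  exists C6 : R,
    forall (E : state R N) (n : nat), pos_state E -> (1 <= n)%N ->
      (surv K TL TR h eta M0 M1 n E
         <= (C6 * (Num.max 1 (Wf E) + Num.max 1 (Vf eta E))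
               * powR n%:R (- (hat_alpha - eps)))%:E)%E.
Proof.
(* [K >= 1] makes the clock rates positive, and [eta < 1/2] gives [hat_alpha > 1], as the concavity
   argument requires. *)
exists 1 => K K1; exists (1/2); split=> [|eta /andP[eta0 eta1]]; first lra.
exists 1; split=> // h /andP[h0 _] alpha hat_alpha M0 M01 [c0 [c00 drV]].
move=> M1 M11 [delta [delta0 drW]] eps eps0.
have K0 : 0 < K by lra.
have eta01 : 0 < eta < 1 by lra.
have b1 : 1 < hat_alpha by rewrite /hat_alpha; lra.
have alphaE : alpha = 1 - hat_alpha^-1.
  by rewrite /alpha /hat_alpha; congr (1 - _^-1); ring.
rewrite alphaE in drV.
(* Capping [delta] at 1/2 keeps [rho] strictly between 0 and 1 even for large [delta]. *)
pose rho := 1 - Num.min delta (1/2).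
have rho01 : 0 < rho < 1.
  have : 0 < Num.min delta (1/2) by rewrite lt_min delta0; lra.
  have : Num.min delta (1/2) <= 1/2 by rewrite ge_min lexx orbT.
  by rewrite /rho; lra.
have /andP[rho0 rho1] := rho01.
have drho : 1 - delta <= rho.
  by rewrite /rho lerD2l lerN2 ge_min lexx.
have PP := submarkov_Pt hN K0 hTL hTR h0.
have nV := @measurable_on_pos_V R N eta.
have nW := measurable_on_pos_W R N.
have nif := @measurable_on_pos_if R N eta M0.
have PV := op_V_le hN K0 hTL hTR h0 eta01.
have PW := op_W_le hN K0 hTL hTR h0.
have bW0 : 0 <= (4 * TL + 4 * TR) * expR (Lam N K * h).
  by rewrite mulr_ge0 ?expR_ge0//; lra.
(* The partial sums of the nonnegative series [hatPW] lie below it, so its contraction passes to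
   every finite [l]. *)
have contr l (E : state R N) : pos_state E -> Vf eta E <= M0 -> M1 < Wf E ->
    (return_sum (Pt K TL TR h) (Vf eta) (@Wf R N) M0 l E <= (rho * Wf E)%:E)%E.
  move=> E0 VE WE; apply: (@le_trans _ _ (hatPW K TL TR h eta M0 E)).
    apply: nneseries_lim_ge => k _ _.
    exact: (nice_ge0 PP (nice_return PP nW nif k) E0).
  apply: (le_trans (drW E E0 VE WE)); rewrite lee_fin ler_wpM2r//.
  exact: Wf_ge0.
have [C1 [C10 HC1]] := avoid_le PP nV nW nif b1 c00 M01 drV (expR_ge0 _) bW0 PV PW
  (ltW rho0) contr M11.
have [C2 [C20 HC2]] := block_choice b1 eps0 rho01.
exists (C1 * C2) => E n E0 n1.
have [k [L [kLn kL]]] := HC2 n n1.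
(* [surv] unfolds to [avoid] for the kernel [Pt], so the abstract bound applies as it stands. *)
apply: (le_trans (HC1 k L n E E0 kLn)); rewrite lee_fin.
rewrite (mulrAC C1 C2) -[leRHS]mulrA ler_wpM2l//.
by rewrite mulr_ge0// addr_ge0// le_max ler01.
Qed.
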